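(* Consider the Bayesian game described in the context. Suppose that for every $i\in N$: (A1) for every measurable set $S\subset\Theta_{-i}$, $\eta_i(S|\theta_i)$ is continuous in $\theta_i$; (A2) there exist positive constants $\alpha$ and $\nu$ such that for all $f_{-i}\in\mathcal{F}_{-i}$ and $\theta_i\in\Theta_i$, $$-\rho_i(a_i',f_{-i},\theta_i)\ \ge\ -v_i(f_{-i},\theta_i)+\alpha\, d\big(a_i',A_i^*(f_{-i},\theta_i)\big)^{\nu},\qquad \forall a_i'\in\mathcal{A}_i,$$ where $v_i(f_{-i},\theta_i):=\max_{a_i\in\mathcal{A}_i}\rho_i(a_i,f_{-i},\theta_i)$ and $A_i^*(f_{-i},\theta_i):=\arg\max_{a_i\in\mathcal{A}_i}\rho_i(a_i,f_{-i},\theta_i)$; (A3) there exists $\tau_i>0$ such that $|\rho_i(a_i,f_{-i},\theta_i)-\rho_i(a_i,f_{-i},\theta_i')|\le\tau_i\|\theta_i-\theta_i'\|$ for any $a_i\in\mathcal{A}_i$, $f_{-i}\in\mathcal{F}_{-i}$, $\theta_i,\theta_i'\in\Theta_i$; (A4) $\mathcal{A}_i$ and $\Theta_i$ are compact and convex. Assume moreover: (a) for $i\in N$, $u_i(a,\theta)$ is Lipschitz continuous over $\mathcal{A}\times\Theta$ and concave in $a_i$; (b) for any $f',f''\in\mathcal{C}$ with $f'\ne f''$, $$\int_\Theta\sum_{i=1}^n\Big[(u_i)'_{a_i}\big(f_i'(\theta_i),f_{-i}'(\theta_{-i}),\theta;\,f_i''(\theta_i)-f_i'(\theta_i)\big)+(u_i)'_{a_i}\big(f_i''(\theta_i),f_{-i}''(\theta_{-i}),\theta;\,f_i'(\theta_i)-f_i''(\theta_i)\big)\Big]\,\eta(d\theta)>0.$$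 Then the game possesses a unique behavioural function equilibrium.
   Context: Bayesian game: there are $n$ players, $N=\{1,\ldots,n\}$. For each $i$, the type set $\Theta_i\subset\mathbb{R}^{d_i}$ and the action space $\mathcal{A}_i\subset\mathbb{R}^{z_i}$ are non-empty. Put $\Theta=\Theta_1\times\cdots\times\Theta_n$, $\mathcal{A}=\mathcal{A}_1\times\cdots\times\mathcal{A}_n$; the subscript $-i$ denotes the vector (or product) over all players except $i$. Player $i$ has utility $u_i(a,\theta)=u_i(a_i,a_{-i},\theta_i,\theta_{-i})$. The types $\theta$ have joint probability distribution $\eta$ on $\Theta$; $\eta_i(\cdot|\theta_i)$ denotes the conditional probability distribution of $\theta_{-i}$ on $\Theta_{-i}$ given $\theta_i$ (specified for every $\theta_i\in\Theta_i$). $\mathcal{F}_i$ is the set of (measurable) functions $f_i:\Theta_i\to\mathcal{A}_i$ and $\mathcal{C}_i$ the set of continuous functions $f_i:\Theta_i\to\mathcal{A}_i$, both with the infinity norm; $\mathcal{F}=\prod_i\mathcal{F}_i$, $\mathcal{C}=\prod_i\mathcal{C}_i$, $\mathcal{F}_{-i}=\prod_{j\ne i}\mathcal{F}_j$. For $a_i\in\mathcal{A}_i$, $f_{-i}\in\mathcal{F}_{-i}$, $\theta_i\in\Theta_i$, $$\rho_i(a_i,f_{-i},\theta_i):=\int_{\Theta_{-i}}u_i(a_i,f_{-i}(\theta_{-i}),\theta_i,\theta_{-i})\,d\eta_i(\theta_{-i}|\theta_i).$$ A behavioural function equilibrium is an $n$-tuple $f=(f_1,\ldots,f_n)\in\mathcal{F}$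 such that $f_i(\theta_i)\in\arg\max_{a_i\in\mathcal{A}_i}\rho_i(a_i,f_{-i},\theta_i)$ for every $\theta_i\in\Theta_i$ and every $i\in N$. $(u_i)'_{a_i}(a_i,a_{-i},\theta;h)$ denotes the (one-sided) directional derivative of $u_i(\cdot,a_{-i},\theta)$ at $a_i$ in direction $h$. $\|\cdot\|$ is the Euclidean norm and $d(x,B)=\inf_{b\in B}\|x-b\|$. *)

(* Defs.v *)
From HB Require Import structures.
From mathcomp Require Import all_boot all_order all_algebra.
From mathcomp Require Import all_classical all_reals all_analysis.
From mathcomp Require Import measurable_realfun.

Set Implicit Arguments.
Unset Strict Implicit.
Unset Printing Implicit Defensive.
Import Order.TTheory GRing.Theory Num.Theory.
Import numFieldNormedType.Exports.
Local Open Scope classical_set_scope.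
Local Open Scope ring_scope.

Notation borel T := (g_sigma_algebraType (@open T)).

Section profiles.
Context {n : nat}.

Definition others (i : 'I_n) := {j : 'I_n | j != i}.

(* (x_i, x_{-i}), with the coordinates put back in their original order *)
Definition mix (T : 'I_n -> Type) (i : 'I_n) (x : T i)
    (y : forall j : others i, T (sval j)) : forall j, T j :=
  fun j => match eq_comparable j i with
           | left e => ecast k (T k) (esym e) x
           | right ne => y (exist _ j (introN eqP ne))
           end.

Definition but (T : 'I_n -> Type) (i : 'I_n) (x : forall j, T j) :
  forall j : others i, T (sval j) := fun j => x (sval j).

Definition box (T : 'I_n -> Type) (D : forall i, set (T i)) :
  set (forall i, T i) := [set x | forall i, D i (x i)].

Definition box_but (T : 'I_n -> Type) (D : forall i, set (T i)) (i : 'I_n) :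
  set (forall j : others i, T (sval j)) := [set y | forall j, D (sval j) (y j)].

Lemma mix_self T i (x : T i) y : @mix T i x y i = x.
Proof. by rewrite /mix; case: eq_comparable => // e; rewrite (eq_axiomK e). Qed.

Lemma mix_other T i (x : T i) y (j : others i) : @mix T i x y (sval j) = y j.
Proof.
case: j => j ji; rewrite /mix /=; case: eq_comparable => [e|ne]; last first.
  by rewrite (bool_irrelevance (introN eqP ne) ji).
by exfalso; move: ji; rewrite e eqxx.
Qed.

Lemma mix_but T i (x : forall j, T j) : @mix T i (x i) (@but T i x) = x.
Proof.
apply: functional_extensionality_dep => j.
by rewrite /mix; case: eq_comparable => // e; case: i / e.
Qed.

End profiles.

Arguments but {n T} i x _.
Arguments box_but {n T} D i _.

Notation profile R d :=
  (borel (prod_topology (fun i => 'rV[R]_(d i)))).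
Notation profile_but R d i :=
  (borel (prod_topology (fun j : others i => 'rV[R]_(d (sval j))))).

Section euclidean.
Context {R : realType}.

(* the library norm on row vectors is the sup norm *)
Definition enorm k (x : 'rV[R]_k) : R := Num.sqrt (\sum_(j < k) x 0 j ^+ 2).

Definition euclid_dist k (x : 'rV[R]_k) (B : set 'rV[R]_k) : R :=
  inf [set enorm (x - b) | b in B].

Definition profile_edist n (z : 'I_n -> nat)
    (a a' : forall i, 'rV[R]_(z i)) : R :=
  Num.sqrt (\sum_(i < n) enorm (a i - a' i) ^+ 2).

Definition concave_on k (D : set 'rV[R]_k) (g : 'rV[R]_k -> R) :=
  convex_function D (fun x => - g x).

Definition argmax (T : Type) (D : set T) (g : T -> R) : set T :=
  [set x | D x /\ forall y, D y -> g y <= g x].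

(* one-sided: t decreases to 0 *)
Definition dir_deriv k (g : 'rV[R]_k -> R) (x h : 'rV[R]_k) : R :=
  lim ((t^-1 * (g (x + t *: h) - g x)) @[t --> 0^'+]).

End euclidean.

(* The utilities and the conditional distributions are total functions on the
   ambient spaces; their values outside the sets of types and actions are
   irrelevant.  The Borel sigma-algebra of a product of Euclidean spaces is
   taken with respect to the product topology. *)
Unset Implicit Arguments.
Record bayesian_game (R : realType) (n : nat) (d z : 'I_n -> nat) := BayesianGame {
  types : forall i, set 'rV[R]_(d i);
  actions : forall i, set 'rV[R]_(z i);
  types_neq0 : forall i, types i !=set0;
  actions_neq0 : forall i, actions i !=set0;
  utility : 'I_n -> (forall i, 'rV[R]_(z i)) -> (forall i, 'rV[R]_(d i)) -> R;
  prior : probability (profile R d) R;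
  cond : forall i, 'rV[R]_(d i) -> probability (profile_but R d i) R;
  prior_types : prior (box types) = 1%E;
  cond_types : forall i t, types i t -> cond i t (box_but types i) = 1%E;
  (* cond i t is a regular conditional distribution of th_{-i} given th_i = t *)
  measurable_cond : forall i (S : set (profile_but R d i)), measurable S ->
    measurable_fun (types i : set (borel 'rV[R]_(d i))) (fun t => cond i t S);
  condE : forall i (T : set (borel 'rV[R]_(d i))) (S : set (profile_but R d i)),
    measurable T -> measurable S ->
    prior [set th : profile R d | T (th i) /\ S (but i th)] =
    (\int[prior]_(th in [set th : profile R d | types i (th i) /\ T (th i)])
       cond i (th i) S)%E
}.

Arguments bayesian_game R {n} d z.
Arguments types {R n d z} _ i _.
Arguments actions {R n d z} _ i _.
Arguments utility {R n d z} _ i _ _.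
Arguments prior {R n d z} _.
Arguments cond {R n d z} _ i _.

Section game.
Context {R : realType} {n : nat} {d z : 'I_n -> nat} (G : bayesian_game R d z).

Local Notation strategy := (fun i : 'I_n => 'rV[R]_(d i) -> 'rV[R]_(z i)).

(* Behavioural functions are represented by functions on the ambient space,
   constrained only on the set of types; see eq_strat. *)
Definition measurable_strat (i : 'I_n) (f : strategy i) :=
  (forall t, types G i t -> actions G i (f t)) /\
  measurable_fun (types G i : set (borel 'rV[R]_(d i)))
    (f : borel 'rV[R]_(d i) -> borel 'rV[R]_(z i)).

Definition continuous_strat (i : 'I_n) (f : strategy i) :=
  (forall t, types G i t -> actions G i (f t)) /\
  {within types G i, continuous f}.

Definition eq_strat (f g : forall i, strategy i) :=
  forall i t, types G i t -> f i t = g i t.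

Definition rho (i : 'I_n) (a : 'rV[R]_(z i))
    (f : forall j : others i, strategy (sval j)) (t : 'rV[R]_(d i)) : R :=
  \int[cond G i t]_(s in box_but (types G) i)
    utility G i (mix a (fun j => f j (s j))) (mix t s).

Definition best_responses (i : 'I_n)
    (f : forall j : others i, strategy (sval j)) (t : 'rV[R]_(d i)) :=
  argmax (actions G i) (fun a => rho i a f t).

(* max_{a in A_i} rho_i(a, f_{-i}, t); the supremum is attained when the game has
   compact action sets and Lipschitz utilities *)
Definition value (i : 'I_n)
    (f : forall j : others i, strategy (sval j)) (t : 'rV[R]_(d i)) : R :=
  sup [set rho i a f t | a in actions G i].

Definition bf_equilibrium (f : forall i, strategy i) :=
  (forall i, measurable_strat i (f i)) /\
  forall i t, types G i t -> best_responses i (but i f) t (f i t).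

Definition utility_deriv (i : 'I_n) (ai : 'rV[R]_(z i))
    (am : forall j : others i, 'rV[R]_(z (sval j)))
    (th : forall j, 'rV[R]_(d j)) (h : 'rV[R]_(z i)) : R :=
  dir_deriv (fun x => utility G i (mix x am) th) ai h.

Definition lipschitz_utility (i : 'I_n) :=
  exists L : R, forall a a' th th',
    box (actions G) a -> box (actions G) a' ->
    box (types G) th -> box (types G) th' ->
    `|utility G i a th - utility G i a' th'| <=
      L * Num.sqrt (profile_edist a a' ^+ 2 + profile_edist th th' ^+ 2).

Definition concave_utility (i : 'I_n) :=
  forall a th, box (actions G) a -> box (types G) th ->
    concave_on (actions G i) (fun x => utility G i (mix x (but i a)) th).

End game.

(* Main.v *)
Require Import Defs.
From mathcomp Require Import all_boot all_order all_algebra.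
From mathcomp Require Import all_classical all_reals all_analysis.
From mathcomp Require Import measurable_realfun ring lra.
Import Order.TTheory GRing.Theory Num.Theory.
Import numFieldNormedType.Exports.
Local Open Scope classical_set_scope.
Local Open Scope ring_scope.
Set Implicit Arguments.
Unset Strict Implicit.
Unset Printing Implicit Defensive.

(** Write [D h y] for the prior integral of the sum over the players of the
    one-sided derivative of their utility at [h] in the direction of their own
    component of [y - h] ([total_deriv]).  The hypothesis on directional
    derivatives is that [D f g + D g f > 0] for distinct continuous [f] and [g].
    At a best response of player [i] the [i]-th summand of [D h y] has
    nonpositive integral ([best_response_first_order]), because the conditional
    expectations of its difference quotients are nonpositive
    ([prior_integral_le0]).  Hence two distinct continuous equilibria [f] and [g]
    would satisfy [D f g + D g f <= 0], which is impossible.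

    Every equilibrium is continuous.  Growth and Lipschitz dependence on the type
    make the sets of best responses vary continuously with the type, with an
    explicit modulus.  These sets are singletons when the opponents play
    continuous strategies: otherwise nearest-point projection
    ([continuous_selection]) would give two distinct continuous selections of
    best responses, and passing from one to the other contradicts strict
    monotonicity.  Since the growth constants do not depend on the strategies of
    the opponents, uniqueness of best responses survives pointwise limits
    ([unique_best_response_limit]), and measurable strategies are obtained from
    continuous ones by iterated pointwise limits ([measurable_baire]).  So an
    equilibrium, being a selection of singletons, has the modulus above
    ([best_response_modulus]).

    Existence uses monotonicity in place of a fixed-point theorem.  On the convex
    class of strategies with that modulus, which is compact for uniform
    convergence ([equi_finite_intersection]), one looks for [f] with [0 <= D g f]
    for all [g] in the class (Minty's inequality).  For finitely many [g] the
    matrix of the numbers [D (g j) (g k)] has nonnegative symmetric part, and an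
    optimal strategy of the symmetric game that it defines
    ([symmetric_game_optimal]) gives the weights of a convex combination that
    works, since [D] is concave in its second argument; compactness then gives a
    common solution ([minty_solution]).  Concavity of the utilities along
    segments turns Minty's inequality into [D f g <= 0] for all [g] in the class
    ([minty_stampacchia]).  Taking for [g] the profile [f] with one component
    replaced by the best response to [f], strict monotonicity leaves no
    alternative but that this component was the best response already
    ([equilibrium_exists]). *)

(** * Euclidean geometry *)

Section euclidean_facts.
Context {R : realType}.

Definition sqnorm k (x : 'rV[R]_k) : R := \sum_(j < k) x 0 j ^+ 2.

Lemma sqnorm_ge0 k (x : 'rV[R]_k) : 0 <= sqnorm x.
Proof. by apply: sumr_ge0 => j _; exact: sqr_ge0. Qed.

Lemma ler_entry_norm k (x : 'rV[R]_k) j : `|x 0 j| <= `|x|.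
Proof.
have := mx_normrE x; rewrite /Num.norm /= => ->.
by apply: (le_bigmax _ (fun ij : 'I_1 * 'I_k => `|x ij.1 ij.2|) (0, j)).
Qed.

Lemma norm_le_entries k (x : 'rV[R]_k) e : 0 <= e ->
  (forall j, `|x 0 j| <= e) -> `|x| <= e.
Proof.
move=> e0 xe; have := mx_normrE x; rewrite /Num.norm /= => ->.
by apply: bigmax_le => // -[i j] _ /=; rewrite (ord1 i) xe.
Qed.

Lemma norm_le_enorm k (x : 'rV[R]_k) : `|x| <= enorm x.
Proof.
apply: norm_le_entries => [|j]; first exact: sqrtr_ge0.
rewrite -sqrtr_sqr ler_wsqrtr// (bigD1 j)//= lerDl.
by apply: sumr_ge0 => l _; exact: sqr_ge0.
Qed.

Lemma sqrt_sumsq_le n (x : 'I_n -> R) : (forall i, 0 <= x i) ->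
  Num.sqrt (\sum_(i < n) x i ^+ 2) <= \sum_(i < n) x i.
Proof.
move=> x0; have s0 : 0 <= \sum_(i < n) x i by exact: sumr_ge0.
rewrite -[leRHS]ger0_norm// -sqrtr_sqr ler_wsqrtr// expr2 mulr_suml ler_sum// => i _.
rewrite expr2 ler_wpM2l// (bigD1 i)//= lerDl; exact: sumr_ge0.
Qed.

Lemma enorm_le_norm k (x : 'rV[R]_k) : enorm x <= k%:R * `|x|.
Proof.
have -> : enorm x = Num.sqrt (\sum_(j < k) `|x 0 j| ^+ 2).
  by congr Num.sqrt; apply: eq_bigr => j _; rewrite real_normK// num_real.
apply: (le_trans (sqrt_sumsq_le (fun=> normr_ge0 _))).
apply: (le_trans (ler_sum _ (fun j _ => ler_entry_norm x j))).
by rewrite sumr_const card_ord mulr_natl.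
Qed.

Lemma sqnorm_midpoint k (x y : 'rV[R]_k) :
  sqnorm (2^-1 *: (x + y)) =
  2^-1 * sqnorm x + 2^-1 * sqnorm y - 4^-1 * sqnorm (x - y).
Proof.
rewrite /sqnorm !mulr_sumr -big_split/= -sumrB; apply: eq_bigr => j _.
by rewrite !mxE; field.
Qed.

Lemma normr_le_sqnorm k (x : 'rV[R]_k) : `|x| ^+ 2 <= sqnorm x.
Proof.
have -> : sqnorm x = enorm x ^+ 2 by rewrite sqr_sqrtr// sqnorm_ge0.
by rewrite ler_pXn2r ?nnegrE ?norm_le_enorm//; exact: sqrtr_ge0.
Qed.

Lemma sqnorm_lipschitz k (x y : 'rV[R]_k) C : `|x| <= C -> `|y| <= C ->
  sqnorm x - sqnorm y <= 2 * C * k%:R * `|x - y|.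
Proof.
move=> xC yC; rewrite /sqnorm -sumrB.
apply: (@le_trans _ _ (\sum_(j < k) (2 * C) * `|x - y|)); last first.
  by rewrite sumr_const card_ord -[leLHS]mulr_natr mulrAC.
apply: ler_sum => j _; rewrite subr_sqr mulrC (le_trans (ler_norm _))// normrM.
rewrite ler_pM//; last first.
  by have := ler_entry_norm (x - y) j; rewrite !mxE.
rewrite (le_trans (ler_normD _ _))// mulr_natl mulr2n.
by rewrite lerD// (le_trans (ler_entry_norm _ _)).
Qed.

Lemma sqnorm0 k : sqnorm (0 : 'rV[R]_k) = 0.
Proof. by rewrite /sqnorm big1// => j _; rewrite mxE expr0n. Qed.

Lemma euclid_dist_near k (x : 'rV[R]_k) (B : set 'rV[R]_k) e :
  B !=set0 -> euclid_dist x B < e -> exists2 b, B b & enorm (x - b) < e.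
Proof.
move=> [b Bb] /inf_lt[|_ [c Bc <-]]; first by exists (enorm (x - b)); exists b.
by exists c.
Qed.

End euclidean_facts.

(** * One-sided derivatives of concave functions *)

Section convexity.
Context {R : realType} {k : nat}.
Implicit Types (A : set 'rV[R]_k) (x y : 'rV[R]_k).

Lemma convexE A x y (s : R) : convex_set A -> A x -> A y -> 0 <= s <= 1 ->
  A (x + s *: (y - x)).
Proof.
move=> cA Ax Ay /andP[s0 s1].
pose p : {i01 R} := Itv01 s0 s1.
have := cA y x p (mem_set Ay) (mem_set Ax).
rewrite inE; congr A.
change (s *: y + (1 - s) *: x = x + s *: (y - x)).
by rewrite scalerBr scalerBl scale1r addrCA.
Qed.

Lemma concaveE A g x y (s : R) : concave_on A g -> A x -> A y -> 0 <= s <= 1 ->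
  g x + s * (g y - g x) <= g (x + s *: (y - x)).
Proof.
move=> cA Ax Ay /andP[s0 s1].
pose p : {i01 R} := Itv01 s0 s1.
have := cA p y x (mem_set Ay) (mem_set Ax).
have -> : x + s *: (y - x) = s *: y + (1 - s) *: x.
  by rewrite scalerBr scalerBl scale1r addrCA.
change (- g (s *: y + (1 - s) *: x) <= s * - g y + (1 - s) * - g x -> 
  g x + s * (g y - g x) <= g (s *: y + (1 - s) *: x)).
by lra.
Qed.

End convexity.

Section concave_derivative.
Context {R : realType} {k : nat}.
Variables (A : set 'rV[R]_k) (g : 'rV[R]_k -> R) (L : R).
Hypotheses (cA : convex_set A) (cg : concave_on A g) (L0 : 0 <= L)
  (Lg : forall x y, A x -> A y -> `|g x - g y| <= L * `|x - y|).
Implicit Types (x y : 'rV[R]_k).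

Definition slope x y (s : R) : R := s^-1 * (g (x + s *: (y - x)) - g x).

Lemma slope_antitone x y (s t : R) : A x -> A y -> 0 < s -> s <= t -> t <= 1 ->
  slope x y t <= slope x y s.
Proof.
move=> Ax Ay s0 st t1; have t0 : 0 < t by lra.
have Az : A (x + t *: (y - x)) by apply: convexE => //; lra.
have st01 : 0 <= s / t <= 1.
  by rewrite divr_ge0 ?(ltW s0) ?(ltW t0)//= ler_pdivrMr// mul1r.
have := concaveE cg Ax Az st01.
have -> : x + (s / t) *: (x + t *: (y - x) - x) = x + s *: (y - x).
  by apply/rowP => j; rewrite !mxE; field; rewrite gt_eqF.
rewrite -lerBrDl => h.
rewrite /slope ler_pdivlMl//; apply: le_trans h.
by rewrite mulrA.
Qed.

Lemma slope_bounded x y (s : R) : A x -> A y -> 0 < s -> s <= 1 ->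
  `|slope x y s| <= L * `|y - x|.
Proof.
move=> Ax Ay s0 s1; rewrite /slope normrM gtr0_norm ?invr_gt0//.
rewrite ler_pdivrMl//.
have Az : A (x + s *: (y - x)) by apply: convexE => //; lra.
apply: (le_trans (Lg Az Ax)).
by rewrite [X in `|X|]addrC addKr normrZ gtr0_norm// mulrCA.
Qed.

(** Slopes of a concave function grow as the step shrinks, so their one-sided
    limit exists and is their supremum. *)
Lemma cvg_slope x y : A x -> A y ->
  slope x y t @[t --> 0^'+] --> dir_deriv g x (y - x).
Proof.
move=> Ax Ay.
pose D := sup [set slope x y s | s in [set s | 0 < s <= 1]].
have hs : has_sup [set slope x y s | s in [set s | 0 < s <= 1]].
  split; first by exists (slope x y 1); exists 1 => //=; rewrite ltr01 lexx.
  exists (L * `|y - x|) => _ [s /= /andP[s0 s1] <-].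
  by rewrite (le_trans (ler_norm _))// slope_bounded.
suff h : slope x y t @[t --> 0^'+] --> D by rewrite /dir_deriv (cvg_lim _ h).
apply/cvgrPdist_le => e e0.
have [_ [s /andP[s0 s1] <-]] := sup_adherent e0 hs => Ds.
near=> t.
have t0 : 0 < t by near: t; exact: nbhs_right_gt.
have ts : t < s by near: t; exact: nbhs_right_lt.
have : slope x y s <= slope x y t by apply: slope_antitone => //; lra.
have tD : slope x y t <= D.
  by apply: ub_le_sup; [case: hs|exists t => //=; lra].
by rewrite ger0_norm; rewrite -/D in Ds; lra.
Unshelve. all: by end_near.
Qed.

Lemma cvg_slope_seq x y : A x -> A y ->
  slope x y (n.+1%:R^-1) @[n --> \oo] --> dir_deriv g x (y - x).
Proof.
move=> Ax Ay; have := cvg_slope Ax Ay.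
move=> /cvg_at_rightP; apply; split; last exact: cvg_harmonic.
by move=> n; rewrite invr_gt0.
Qed.

Lemma dir_deriv_lipschitz x y y' : A x -> A y -> A y' ->
  dir_deriv g x (y - x) - dir_deriv g x (y' - x) <= L * `|y - y'|.
Proof.
move=> Ax Ay Ay'.
apply: (cvgr_to_le (cvgB (cvg_slope_seq Ax Ay) (cvg_slope_seq Ax Ay'))).
near=> n; have n0 : 0 < n.+1%:R^-1 :> R by rewrite invr_gt0.
have n1 : n.+1%:R^-1 <= 1 :> R by rewrite invf_le1// ler1n.
rewrite !fctE /=; set s := n.+1%:R^-1 in n0 n1 *.
rewrite /slope -mulrBr opprB addrA subrK ler_pdivrMl//.
have Az : A (x + s *: (y - x)) by apply: convexE => //; lra.
have Az' : A (x + s *: (y' - x)) by apply: convexE => //; lra.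
apply: (le_trans (ler_norm _)); apply: (le_trans (Lg Az Az')).
rewrite mulrCA ler_wpM2l// opprD addrACA subrr add0r -scalerBr.
by rewrite opprB addrA subrK normrZ gtr0_norm.
Unshelve. all: by end_near.
Qed.

Lemma dir_deriv_concave x y y' (t : R) : A x -> A y -> A y' -> 0 <= t <= 1 ->
  dir_deriv g x (y - x) + t * (dir_deriv g x (y' - x) - dir_deriv g x (y - x)) <=
  dir_deriv g x (y + t *: (y' - y) - x).
Proof.
move=> Ax Ay Ay' t01.
have Az : A (y + t *: (y' - y)) by apply: convexE.
rewrite -subr_ge0.
have cy := cvg_slope_seq Ax Ay; have cy' := cvg_slope_seq Ax Ay'.
have cz := cvg_slope_seq Ax Az.
apply: (cvgr_to_ge (cvgB cz (cvgD cy (cvgM (cvg_cst t) (cvgB cy' cy))))).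
near=> n; have n0 : 0 < n.+1%:R^-1 :> R by rewrite invr_gt0.
have n1 : n.+1%:R^-1 <= 1 :> R by rewrite invf_le1// ler1n.
rewrite !fctE /=; set s := n.+1%:R^-1 in n0 n1 *.
have Aw : A (x + s *: (y - x)) by apply: convexE => //; lra.
have Aw' : A (x + s *: (y' - x)) by apply: convexE => //; lra.
have := concaveE cg Aw Aw' t01.
have -> : x + s *: (y - x) + t *: (x + s *: (y' - x) - (x + s *: (y - x))) =
   x + s *: (y + t *: (y' - y) - x).
  by apply/rowP => j; rewrite !mxE; ring.
rewrite -subr_ge0 => h.
have si0 : 0 <= s^-1 by rewrite invr_ge0 ltW.
have := mulr_ge0 si0 h; congr (0 <= _); rewrite /slope /=; ring.
Unshelve. all: by end_near.
Qed.

Lemma dir_deriv0 x : dir_deriv g x 0 = 0.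
Proof.
rewrite /dir_deriv; apply: cvg_lim => //.
under eq_fun do rewrite scaler0 addr0 subrr mulr0.
exact: cvg_cst.
Qed.

(** Along a line, the slope of a concave function ahead of [z] is at most its
    slope behind [z], and the latter tends to minus the one-sided derivative in
    the backward direction. *)
Lemma slope_le_opp_dir_deriv x y z (s t : R) : A x -> A y -> 0 < s -> 0 < t ->
  s + t <= 1 -> z = x + t *: (y - x) ->
  s^-1 * (g (z + s *: (y - x)) - g z) <= - (t^-1 * dir_deriv g z (x - z)).
Proof.
move=> Ax Ay s0 t0 st zE.
have Az : A z by rewrite zE; apply: convexE => //; lra.
pose w := z + s *: (y - x).
have Aw : A w.
  rewrite /w zE -addrA -scalerDl; apply: convexE => //; lra.
rewrite -mulrN ler_pdivlMl// lerNr.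
apply: (cvgr_to_le (cvg_slope Az Ax)); near=> r.
have r0 : 0 < r by near: r; exact: nbhs_right_gt.
have r1 : r < 1 by near: r; exact: nbhs_right_lt.
have Av : A (z + r *: (x - z)) by apply: convexE => //; lra.
(* [z] divides the segment from [z + r *: (x - z)] to [w] in the ratio [r * t : s]. *)
pose q := r * t / (r * t + s).
have rt0 : 0 < r * t by exact: mulr_gt0.
have den0 : 0 < r * t + s by lra.
have q01 : 0 <= q <= 1.
  by rewrite divr_ge0 ?(ltW rt0) ?(ltW den0)//= ler_pdivrMr// mul1r; lra.
have := concaveE cg Av Aw q01.
have -> : z + r *: (x - z) + q *: (w - (z + r *: (x - z))) = z.
  apply/rowP => j; rewrite /q /w zE !mxE; field.
  by rewrite gt_eqF.
rewrite /slope -/w; set gv := g _; move=> h.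
rewrite ler_pdivrMl//.
have : q * (g w - gv) <= g z - gv by lra.
rewrite /q mulrAC ler_pdivrMr// => h2.
rewrite -(ler_pM2l s0).
have -> : s * (r * - (t * (s^-1 * (g w - g z)))) = - (r * t * (g w - g z)).
  by field; rewrite gt_eqF.
by nra.
Unshelve. all: by end_near.
Qed.

End concave_derivative.

(** * Symmetric games *)

Lemma cvg_sumr (R : realType) (T : Type) (F : set_system T) {FF : Filter F}
    (I : Type) (r : seq I) (f : I -> T -> R) (a : I -> R) :
  (forall i, f i x @[x --> F] --> a i) ->
  \sum_(i <- r) f i x @[x --> F] --> \sum_(i <- r) a i.
Proof. by move=> fa; apply: cvg_big => //; exact: add_continuous. Qed.

Section symmetric_game.
Context {R : realType} {m : nat}.
Variable M : 'I_m.+1 -> 'I_m.+1 -> R.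
Hypothesis M0 : forall j k, 0 <= M j k + M k j.

Let pay (l : 'rV[R]_m.+1) j : R := \sum_k l 0 k * M j k.
Let deficit (l : 'rV[R]_m.+1) j : R := Num.max 0 (- pay l j).
Let simplex : set 'rV[R]_m.+1 :=
  [set l | (forall k, 0 <= l 0 k) /\ \sum_k l 0 k = 1].

Let entry_cont k : continuous (fun l : 'rV[R]_m.+1 => l 0 k).
Proof. exact: coord_continuous. Qed.

Let pay_cont j : continuous (fun l => pay l j).
Proof.
move=> l; apply: (@cvg_sumr _ _ (nbhs l)) => k.
by apply: cvgM; [exact: entry_cont|exact: cvg_cst].
Qed.

Let deficit_cont j : continuous (fun l => deficit l j).
Proof.
move=> l; apply: (@continuous_max _ _ (fun=> 0) (fun l => - pay l j)).
  exact: (@cst_continuous _ _ 0).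
by apply: (@continuousN _ _ _ (fun l => pay l j)); exact: pay_cont.
Qed.

Let simplex_compact : compact simplex.
Proof.
apply: bounded_closed_compact.
  exists 1; split; first exact: num_real.
  move=> C C1 l [l0 l1]; apply: norm_le_entries; first by rewrite ltW// (lt_trans ltr01).
  move=> k; rewrite ger0_norm// (le_trans _ (ltW C1))// -l1 (bigD1 k)//= lerDl.
  exact: sumr_ge0.
have -> : simplex = (\bigcap_(k in setT) [set l | 0 <= l 0 k]) `&`
                   [set l | \sum_k l 0 k = 1].
  by apply/seteqP; split => [l [l0 l1]|l [l0 l1]]; split => // k; [move=> _|]; apply: l0.
apply: closedI.
  apply: closed_bigI => k _.
  apply: (@preimage_closed _ _ (fun l : 'rV[R]_m.+1 => l 0 k) [set x | 0 <= x]).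
    by move=> x _; exact: entry_cont.
  exact: closed_ge.
apply: (@preimage_closed _ _ (fun l : 'rV[R]_m.+1 => \sum_k l 0 k) [set x | x = 1]).
  by move=> l _; apply: (@cvg_sumr _ _ (nbhs l)) => k; exact: entry_cont.
exact: closed_eq.
Qed.

(** For a skew matrix this is the optimal strategy of a symmetric zero-sum game.
    Minimise the total squared deficit over the simplex.  At a minimiser [l]
    with deficits [p], moving towards the mixed strategy proportional to [p]
    decreases the objective to first order by at least twice its value, because
    the quadratic form of [M] is nonnegative at [p]; so the minimum is zero. *)
Lemma symmetric_game_optimal : exists l : 'I_m.+1 -> R,
  [/\ forall k, 0 <= l k, \sum_k l k = 1 &
      forall j, 0 <= \sum_k l k * M j k].
Proof.
have s0 : simplex !=set0.
  exists (delta_mx 0 0); split=> [k|]; first by rewrite mxE ler0n.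
  rewrite (bigD1 ord0)//= mxE !eqxx big1 ?addr0// => k /negPf k0.
  by rewrite mxE eqxx k0.
pose Phi l := \sum_j deficit l j ^+ 2.
have Phic : {within simplex, continuous Phi}.
  apply: continuous_subspaceT => l; apply: (@cvg_sumr _ _ (nbhs l)) => j.
  by apply: cvgM; exact: deficit_cont.
have [l /set_mem [l0 l1] lmin] := EVT_min_rV s0 simplex_compact Phic.
exists (fun k => l 0 k); split => // j0.
pose p j := deficit l j.
have p0 j : 0 <= p j by rewrite /p /deficit le_max lexx.
have pp j : p j * pay l j = - p j ^+ 2.
  by rewrite /p /deficit; case: (leP 0 (- pay l j)) => _; ring.
suff Phi0 : Phi l = 0.
  have : p j0 ^+ 2 = 0.
    apply/eqP; move/eqP: Phi0; rewrite psumr_eq0; last by move=> j _; exact: sqr_ge0.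
    by move=> /allP /(_ j0); rewrite mem_index_enum => /(_ isT).
  move=> /eqP; rewrite sqrf_eq0 => /eqP pj.
  have : - pay l j0 <= p j0 by rewrite /p /deficit le_max lexx orbT.
  by rewrite pj oppr_le0.
pose P := \sum_j p j.
have [P0|P0] := eqVneq P 0.
  rewrite /Phi big1// => j _; move/eqP: P0; rewrite psumr_eq0//.
  move=> /allP /(_ j); rewrite mem_index_enum => /(_ isT) /= /eqP; rewrite /p => ->.
  by rewrite expr0n.
have Pgt0 : 0 < P by rewrite lt_neqAle eq_sym P0 sumr_ge0.
pose q : 'rV[R]_m.+1 := \row_j (p j / P).
have q0 k : 0 <= q 0 k by rewrite mxE divr_ge0// ltW.
have q1 : \sum_k q 0 k = 1.
  by under eq_bigr do rewrite mxE; rewrite -mulr_suml divff.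
pose v j := pay q j - pay l j.
have pq : 0 <= \sum_j p j * pay q j.
  have -> : \sum_j p j * pay q j = P^-1 * \sum_j \sum_k p j * p k * M j k.
    rewrite mulr_sumr; apply: eq_bigr => j _; rewrite /pay !mulr_sumr.
    by apply: eq_bigr => k _; rewrite mxE; ring.
  rewrite mulr_ge0 ?invr_ge0 ?(ltW Pgt0)//.
  rewrite -(pmulr_lge0 _ (ltr0n R 2)) mulr_natr mulr2n.
  rewrite {2}exchange_big -big_split sumr_ge0// => j _.
  rewrite -big_split sumr_ge0// => k _ /=.
  rewrite [p k * _]mulrC -mulrDr mulr_ge0// mulr_ge0//.
pose V := \sum_j v j ^+ 2.
have V0 : 0 <= V by apply: sumr_ge0 => j _; exact: sqr_ge0.
(* The objective at [l + e *: (q - l)], with the truncation of the new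
   deficits bounded by [p j - e * v j]. *)
have key e : 0 < e -> e <= 1 -> Phi l <= e * V.
  move=> e0 e1; pose le := l + e *: (q - l).
  have sle : simplex le.
    split=> [k|].
      rewrite !mxE; have := l0 k; have := q0 k; rewrite mxE; nra.
    have -> : \sum_k le 0 k = \sum_k l 0 k + e * (\sum_k q 0 k - \sum_k l 0 k).
      rewrite -sumrB mulr_sumr -big_split; apply: eq_bigr => k _.
      by rewrite /le !mxE.
    by rewrite l1 q1; ring.
  have payle j : pay le j = pay l j + e * v j.
    rewrite /v /pay -sumrB mulr_sumr -big_split; apply: eq_bigr => k _ /=.
    by rewrite !mxE; ring.
  have : Phi l <= Phi le by apply: lmin; rewrite inE.
  have : Phi le <= \sum_j (p j - e * v j) ^+ 2.
    apply: ler_sum => j _; rewrite /deficit payle.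
    have : - pay l j <= p j by rewrite /p /deficit le_max lexx orbT.
    case: (leP 0 (- (pay l j + e * v j))) => u0 lp; last by rewrite expr0n sqr_ge0.
    by rewrite ler_pXn2r// ?nnegrE; lra.
  have -> : \sum_j (p j - e * v j) ^+ 2 =
     Phi l - 2 * e * (\sum_j p j * v j) + e ^+ 2 * V.
    rewrite !mulr_sumr -sumrB -big_split; apply: eq_bigr => j _ /=.
    by rewrite -/(p j); ring.
  have -> : \sum_j p j * v j = \sum_j p j * pay q j + Phi l.
    rewrite -big_split; apply: eq_bigr => j _ /=.
    by rewrite /v mulrBr pp -/(p j); ring.
  have PhiG : 0 <= Phi l by apply: sumr_ge0 => j _; exact: sqr_ge0.
  move=> h1 h2.
  have : e * (2 * Phi l) <= e * (e * V) by nra.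
  by rewrite ler_pM2l//; nra.
apply/eqP; rewrite eq_le; apply/andP; split; last first.
  by apply: sumr_ge0 => j _; exact: sqr_ge0.
apply/ler_addgt0Pr => e e0; rewrite add0r.
pose s := Num.min 1 (e / (V + 1)).
have s0' : 0 < s by rewrite lt_min ltr01 divr_gt0//; lra.
apply: (le_trans (key s s0' _)); first by rewrite ge_min lexx.
have : s <= e / (V + 1) by rewrite ge_min lexx orbT.
by rewrite ler_pdivlMr; nra.
Qed.

End symmetric_game.

(** * Equicontinuous families of strategies *)

Section metric_facts.
Context {R : realType} {k l : nat}.

Lemma continuous_withinP (D : set 'rV[R]_k) (f : 'rV[R]_k -> 'rV[R]_l) :
  {within D, continuous f} <->
  forall x, D x -> forall e, 0 < e -> exists2 r, 0 < r &
    forall y, D y -> `|x - y| < r -> `|f x - f y| < e.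
Proof.
split=> [/subspace_continuousP fc x Dx e e0|fc].
  have /cvgrPdist_lt /(_ _ e0) := fc _ Dx.
  rewrite near_withinE => /nbhs_ballP[r /= r0 h]; exists r => // y Dy xy.
  by apply: h => //; rewrite -ball_normE.
apply/subspace_continuousP => x Dx; apply/cvgrPdist_lt => e e0.
have [r r0 h] := fc _ Dx _ e0.
rewrite near_withinE; apply/nbhs_ballP; exists r => //= y; rewrite -ball_normE /=.
by move=> xy Dy; exact: h.
Qed.

Lemma finite_net (D : set 'rV[R]_k) (e : R) : compact D -> 0 < e ->
  exists s : seq 'rV[R]_k, (forall x, x \in s -> D x) /\
    forall t, D t -> exists2 x, x \in s & `|x - t| < e.
Proof.
move=> cD e0; move: (cD); rewrite compact_cover => /(_ _ D (fun x => ball x e)).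
case=> [x _|t Dt|s sD Ds]; first exact: ball_open.
  by exists t => //; exact: ballxx.
exists (finmap.enum_fset s); split=> [x xs|t /Ds [x /= xs]].
  by have := sD _ xs; rewrite inE.
by rewrite -ball_normE; exists x.
Qed.

End metric_facts.

Definition segment (R : realType) (n : nat) (d z : 'I_n -> nat)
    (f g : forall i, 'rV[R]_(d i) -> 'rV[R]_(z i)) (s : R) :
    forall i, 'rV[R]_(d i) -> 'rV[R]_(z i) :=
  fun i t => f i t + s *: (g i t - f i t).
Arguments segment {R n d z} f g s i t.

Section equicontinuous.
Context {R : realType} {n : nat} {d z : 'I_n -> nat}.
Variables (D : forall i, set 'rV[R]_(d i)) (A : forall i, set 'rV[R]_(z i)).
Variable w : forall i : 'I_n, 'rV[R]_(d i) -> 'rV[R]_(d i) -> R.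
Arguments D : clear implicits.
Arguments A : clear implicits.
Arguments w : clear implicits.
Hypotheses (cD : forall i, compact (D i)) (cA : forall i, compact (A i)).
Hypothesis wsmall : forall i (e : R), 0 < e -> exists2 r, 0 < r &
  forall t t', D i t -> D i t' -> `|t - t'| < r -> w i t t' <= e.

Local Notation profile_fun := (forall i, 'rV[R]_(d i) -> 'rV[R]_(z i)).

(** The range condition holds on the whole space, not only on [D]: this makes
    the family a closed part of a full product of compact sets. *)
Definition equi (f : profile_fun) :=
  (forall i t, A i (f i t)) /\
  forall i t t', D i t -> D i t' -> `|f i t - f i t'| <= w i t t'.

(** Ascoli's theorem in the form of a finite intersection property: pointwise
    limits come from Tychonoff's theorem, and equicontinuity makes the
    convergence uniform. *)
Lemma equi_finite_intersection (J : Type) (C : J -> set profile_fun) :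
  (forall m (g : 'I_m -> J), exists2 f, equi f & forall k, C (g k) f) ->
  exists2 f, equi f & forall j e, 0 < e -> exists2 h, equi h & C j h /\
    forall i t, D i t -> `|h i t - f i t| <= e.
Proof.
move=> fip.
(* Finite families of indices generate the filter; [none] is the empty one. *)
pose none := existT (fun m => 'I_m -> J) 0%N
  (fun k => match notF (ltn_ord k) with end).
pose P : eqType := {i : 'I_n & 'rV[R]_(d i)}.
pose T (p : P) : topologicalType := 'rV[R]_(z (tag p)).
pose unc (f : profile_fun) : forall p : P, T p := fun p => f (tag p) (tagged p).
pose B (s : {m & 'I_m -> J}) : set (forall p, T p) :=
  [set unc f | f in [set f | equi f /\ forall k, C (projT2 s k) f]].
pose F := filter_from [set: {m & 'I_m -> J}] B.
have FF : ProperFilter F.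
  apply: filter_from_proper; last first.
    move=> [m g] _; have [f ef Cf] := fip m g.
    by exists (unc f); exists f.
  apply: filter_from_filter; first by exists none.
  move=> [m1 g1] [m2 g2] _ _.
  exists (existT (fun m => 'I_m -> J) (m1 + m2)%N (fun k : 'I_(m1 + m2) =>
    match fintype.split k with inl a => g1 a | inr b => g2 b end)) => //.
  move=> _ [f [ef Cf] <-]; split; exists f => //; split => // k /=.
    by have /= := Cf (unsplit (inl k)); rewrite -[lshift _ _]/(unsplit (inl k)) unsplitK.
  by have /= := Cf (unsplit (inr k)); rewrite -[rshift _ _]/(unsplit (inr k)) unsplitK.
pose S : set (prod_topology T) := [set f | forall p, A (tag p) (f p)].
have cB : compact S.
  by apply: (@tychonoff P T (fun p => A (tag p))) => p; exact: cA.
have FA : F S.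
  exists none => //.
  by move=> _ [f [[Af _] _] <-] p; exact: Af.
have [p [pA pF]] := cB F FF FA.
pose f : profile_fun := fun i t => p (Tagged (fun i => 'rV[R]_(d i)) t).
have FN : Filter (nbhs (p : prod_topology T)) by apply: nbhs_filter.
have near_pt i (t : 'rV[R]_(d i)) (e : R) : 0 < e ->
    nbhs (p : prod_topology T) [set q : forall p, T p |
      `|(q (Tagged (fun i => 'rV[R]_(d i)) t) : 'rV[R]_(z i)) - f i t| < e].
  move=> e0.
  have h : nbhs (f i t) (ball (f i t) e) by exact: nbhsx_ballx.
  pose U : set (prod_topology T) :=
    [set q : forall p, T p | ball (f i t) e (q (Tagged (fun i => 'rV[R]_(d i)) t))].
  have pU : nbhs (p : prod_topology T) U :=
    @proj_continuous P T (Tagged (fun i => 'rV[R]_(d i)) t) p _ h.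
  apply: (@filterS _ _ FN U) pU => q.
  by rewrite /U /= -ball_normE /= distrC.
have clus (s : {m & 'I_m -> J}) V : nbhs (p : prod_topology T) V -> exists2 h, equi h &
    (forall k, C (projT2 s k) h) /\ V (unc h).
  move=> pV; have [|_ [[h [eh Ch] <-] Vh]] := pF (B s) V _ pV; first by exists s.
  by exists h.
have ef : equi f.
  split=> [i t|i t t' Dt Dt']; first exact: (pA (Tagged (fun i => 'rV[R]_(d i)) t)).
  apply/ler_addgt0Pr => e e0; have e2 : 0 < e / 2 by exact: divr_gt0.
  have [h [_ hw] [_ /= [h1 h2]]] :=
    clus none _ (@filterI _ _ FN _ _ (near_pt i t _ e2) (near_pt i t' _ e2)).
  have := hw _ _ _ Dt Dt'; rewrite /unc /= in h1 h2 *; move=> hw'.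
  have -> : f i t - f i t' = - (h i t - f i t) + ((h i t - h i t') + (h i t' - f i t')).
    by apply/rowP => j; rewrite !mxE; ring.
  rewrite (le_trans (ler_normD _ _))// normrN.
  by have := ler_normD (h i t - h i t') (h i t' - f i t'); lra.
exists f => // j e e0.
have e3 : 0 < e / 3 by exact: divr_gt0.
(* A neighbourhood of [p] in the pointwise topology that controls a finite
   net of [D i] controls all of [D i], by equicontinuity. *)
have nearD i : nbhs (p : prod_topology T) [set q : forall p, T p | forall h, q = unc h -> equi h ->
    forall t, D i t -> `|h i t - f i t| <= e].
  have [r r0 rw] := wsmall i e3.
  have [s [sD sn]] := finite_net (@cD i) r0.
  have : nbhs (p : prod_topology T) [set q : forall p, T p | forall x, x \in s ->
      `|(q (Tagged (fun i => 'rV[R]_(d i)) x) : 'rV[R]_(z i)) - f i x| < e / 3].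
    elim: s {sD sn} => [|x s IH]; first by apply: (@filterE _ _ FN) => q x.
    apply: (@filterS2 _ _ FN _ _ _ _ (near_pt i x _ e3) IH) => q qx qs y.
    by rewrite inE => /predU1P[->|/qs].
  apply: (@filterS _ _ FN) => q qs h qh eh t Dt.
  have [x xs xt] := sn _ Dt; have Dx := sD _ xs.
  have := qs _ xs; rewrite qh /unc /= => hx.
  have hw := (proj2 eh) _ _ _ Dx Dt; have fw := (proj2 ef) _ _ _ Dx Dt.
  have wx := rw _ _ Dx Dt xt.
  have -> : h i t - f i t = - (h i x - h i t) + ((h i x - f i x) + (f i x - f i t)).
    by apply/rowP => j0; rewrite !mxE; ring.
  rewrite (le_trans (ler_normD _ _))// normrN.
  by have := ler_normD (h i x - f i x) (f i x - f i t); lra.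
have : nbhs (p : prod_topology T) [set q : forall p, T p | forall i h, q = unc h -> equi h ->
    forall t, D i t -> `|h i t - f i t| <= e].
  by apply: (@filter_forall _ _ _ _ FN) => i; exact: nearD.
move=> /(clus (existT (fun m => 'I_m -> J) 1%N (fun=> j)))[h eh [Ch Vh]].
exists h => //; split; first exact: Ch ord0.
by move=> i t Dt; exact: Vh.
Qed.

End equicontinuous.

(** * Continuous selections *)

Section selection.
Context {R : realType} {k l : nat}.
Variables (D : set 'rV[R]_k) (A : set 'rV[R]_l) (B : 'rV[R]_k -> set 'rV[R]_l).
Hypotheses (cA : compact A) (BA : forall t, D t -> B t `<=` A)
  (B0 : forall t, D t -> B t !=set0) (clB : forall t, D t -> closed (B t))
  (cB : forall t, D t -> convex_set (B t))
  (BH : forall e : R, 0 < e -> exists2 r, 0 < r & forall t t', D t -> D t' ->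
    `|t - t'| < r -> forall x, B t x -> exists2 y, B t' y & `|x - y| <= e).

Lemma sqnorm_continuous (p : 'rV[R]_l) : continuous (fun x : 'rV[R]_l => sqnorm (p - x)).
Proof.
move=> x; apply: (@cvg_sumr _ _ (nbhs x)) => j.
have c : {for x, continuous (fun y : 'rV[R]_l => (p - y) 0 j)}.
  have -> : (fun y : 'rV[R]_l => (p - y) 0 j) = (fun y => p 0 j - y 0 j).
    by apply/funext => y; rewrite !mxE.
  apply: (@continuousB _ _ _ (fun=> p 0 j) (fun y : 'rV[R]_l => y 0 j)).
    exact: cst_continuous.
  exact: coord_continuous.
exact: (continuousM c c).
Qed.

(** The nearest-point selection.  If [x] and [y] are nearest to [p] in two sets
    at Hausdorff distance [r], the parallelogram law bounds [`|x - y| ^+ 2] by a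
    multiple of [r]. *)
Lemma continuous_selection (p : 'rV[R]_l) : exists s : 'rV[R]_k -> 'rV[R]_l,
  [/\ forall t, D t -> B t (s t), {within D, continuous s} &
      forall t, D t -> B t p -> s t = p].
Proof.
have nearest t : exists x, D t -> B t x /\
    forall y, B t y -> sqnorm (p - x) <= sqnorm (p - y).
  case: (pselect (D t)) => Dt; last by exists 0.
  have cBt : compact (B t) := subclosed_compact (clB Dt) cA (BA Dt).
  have [c /set_mem Bc cmin] := EVT_min_rV (B0 Dt) cBt
    (continuous_subspaceT (@sqnorm_continuous p)).
  by exists c => _; split => // y By; apply: cmin; rewrite inE.
have [s sP] := choice nearest.
exists s; split=> [t /sP[]//||t Dt Bp]; last first.
  have := (sP _ Dt).2 _ Bp; rewrite subrr sqnorm0 => h.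
  apply/eqP; rewrite eq_sym -subr_eq0 -normr_eq0 -sqrf_eq0 eq_le sqr_ge0 andbT.
  exact: le_trans (normr_le_sqnorm _) h.
have [C [C0 HC]] : exists C, 0 <= C /\ forall x, A x -> `|p - x| <= C.
  have [M [_ HM]] := compact_bounded cA.
  exists (`|p| + (`|M| + 1)); split; first by rewrite !addr_ge0.
  move=> x Ax; rewrite (le_trans (ler_normB _ _))// lerD2l.
  by apply: HM => //; rewrite ltr_pwDr// ler_norm.
apply/continuous_withinP => t Dt e e0.
pose K := 2 * C * l%:R; have K0 : 0 <= K by rewrite !mulr_ge0.
pose q := e / 3; have q0 : 0 < q by exact: divr_gt0.
(* Small enough for [4 * K * h <= q ^+ 2], the bound on [`|y - x'| ^+ 2] below. *)
pose h := Num.min q (q ^+ 2 / (4 * K + 1)).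
have h0 : 0 < h by rewrite lt_min q0/= divr_gt0 ?exprn_gt0//; lra.
have [r r0 Hr] := BH h0; exists r => // t' Dt' tt'.
have [Bx xmin] := sP _ Dt; have [By ymin] := sP _ Dt'.
set x := s t in Bx xmin *; set y := s t' in By ymin *.
have [x' Bx' xx'] := Hr _ _ Dt Dt' tt' _ Bx.
have [y' By' yy'] : exists2 y', B t y' & `|y - y'| <= h.
  by apply: (Hr t') => //; rewrite distrC.
have bd u v : A u -> A v -> `|u - v| <= h ->
    sqnorm (p - u) <= sqnorm (p - v) + K * h.
  move=> Au Av uv; rewrite -lerBlDl (le_trans (sqnorm_lipschitz (HC _ Au) (HC _ Av)))//.
  by rewrite ler_wpM2l// opprB addrC subrKA distrC.
have h1 := xmin _ By'.
have h2 : sqnorm (p - y') <= sqnorm (p - y) + K * h.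
  by apply: bd; [exact: (BA Dt By')|exact: (BA Dt' By)|rewrite distrC].
have h3 : sqnorm (p - x') <= sqnorm (p - x) + K * h.
  by apply: bd; [exact: (BA Dt' Bx')|exact: (BA Dt Bx)|rewrite distrC].
have Bm : B t' (x' + 2^-1 *: (y - x')) by apply: convexE => //; [exact: cB|lra].
have h4 := ymin _ Bm.
have mE : p - (x' + 2^-1 *: (y - x')) = 2^-1 *: ((p - x') + (p - y)).
  by apply/rowP => j; rewrite !mxE; field.
rewrite mE sqnorm_midpoint in h4.
have dE : p - x' - (p - y) = y - x' by rewrite opprB addrC addrA subrK.
rewrite dE in h4.
have h5 := normr_le_sqnorm (y - x').
have Kh : 4 * K * h <= q ^+ 2.
  have : h <= q ^+ 2 / (4 * K + 1) by rewrite ge_min lexx orbT.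
  rewrite ler_pdivlMr; last by lra.
  by have := ltW h0; nra.
have h6 : `|y - x'| <= q.
  rewrite -(@ler_pXn2r _ 2) ?nnegrE ?(ltW q0)//; lra.
have hq : h <= q by rewrite ge_min lexx.
have -> : x - y = (x - x') - (y - x') by rewrite opprB addrA subrK.
rewrite (le_lt_trans (ler_normB _ _))//.
by rewrite /q in h6 hq; lra.
Qed.

End selection.

(** * Borel strategies as iterated pointwise limits *)

Section distance.
Context {R : realType} {l : nat}.
Implicit Types (C : set 'rV[R]_l) (x y : 'rV[R]_l).

Definition dist_set C x : R := inf [set `|x - c| | c in C].

Let has_inf_dist C x : C !=set0 -> has_inf [set `|x - c| | c in C].
Proof.
move=> [c Cc]; split; first by exists `|x - c|; exists c.
by exists 0 => _ [b _ <-].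
Qed.

Lemma dist_set_ge0 C x : C !=set0 -> 0 <= dist_set C x.
Proof. by move=> [c Cc]; apply: lb_le_inf; [exists `|x - c|; exists c|move=> _ [b _ <-]]. Qed.

Lemma dist_set_lipschitz C x y : C !=set0 ->
  `|dist_set C x - dist_set C y| <= `|x - y|.
Proof.
move=> C0.
have h u v : dist_set C u <= dist_set C v + `|u - v|.
  rewrite -lerBlDr; apply: lb_le_inf => [|_ [c Cc <-]].
    by case: C0 => c Cc; exists `|v - c|; exists c.
  rewrite lerBlDr; apply: (@le_trans _ _ `|u - c|).
    by apply: ge_inf; [case: (has_inf_dist u C0)|exists c].
  have -> : u - c = (v - c) + (u - v) by rewrite [RHS]addrC addrA subrK.
  exact: ler_normD.
have := h x y; have := h y x; rewrite [`|y - x|]distrC => h1 h2.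
by rewrite ler_norml; apply/andP; split; lra.
Qed.

Lemma dist_set_eq0 C x : closed C -> C !=set0 -> (dist_set C x = 0) <-> C x.
Proof.
move=> clC C0; split=> [dx|Cx]; last first.
  apply/eqP; rewrite eq_le dist_set_ge0// andbT.
  by apply: ge_inf; [case: (has_inf_dist x C0)|exists x; rewrite ?subrr ?normr0].
apply: clC => U /nbhs_ballP[e /= e0 eU].
have := inf_adherent e0 (has_inf_dist x C0).
rewrite -/(dist_set C x) dx add0r => -[_ [c Cc <-] xc].
by exists c; split => //; apply: eU; rewrite -ball_normE.
Qed.

End distance.

Section borel_facts.
Context {R : realType}.

Lemma borel_open (T : ptopologicalType) (U : set T) :
  open U -> measurable (U : set (borel T)).
Proof. exact: sub_sigma_algebra. Qed.

Lemma borel_closed (T : ptopologicalType) (U : set T) :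
  closed U -> measurable (U : set (borel T)).
Proof.
by move=> cU; rewrite -[U]setCK; apply: measurableC; apply: borel_open; rewrite openC.
Qed.

Lemma borel_compact k (U : set 'rV[R]_k) :
  compact U -> measurable (U : set (borel 'rV[R]_k)).
Proof. by move=> cU; apply: borel_closed; apply: compact_closed cU; exact: norm_hausdorff. Qed.

Lemma continuous_borel (T S : ptopologicalType) (D : set T) (f : T -> S) :
  measurable (D : set (borel T)) -> {within D, continuous f} ->
  measurable_fun (D : set (borel T)) (f : borel T -> borel S).
Proof.
move=> mD fc; apply: (@measurability _ _ (borel T) (borel S) D f (@open S)) => //.
move=> _ [U oU <-].
have [V oV VE] := iffLR (open_subspaceP _ _) (iffLR (continuousP _) fc _ oU).
rewrite setIC [X in measurable X](_ : _ = V `&` D); last by rewrite -VE.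
by apply: measurableI => //; exact: borel_open.
Qed.

(** A closed set is the zero set of its distance function, which reduces the
    claim to limits of real functions. *)
Lemma borel_measurable_limit d (T : measurableType d) (D : set T) l
    (f_ : nat -> T -> 'rV[R]_l) (f : T -> 'rV[R]_l) : measurable D ->
  (forall m, measurable_fun D (f_ m : T -> borel 'rV[R]_l)) ->
  (forall t, D t -> f_ m t @[m --> \oo] --> f t) ->
  measurable_fun D (f : T -> borel 'rV[R]_l).
Proof.
move=> mD mf ff.
have mclosed C : closed C -> measurable (D `&` f @^-1` C).
  move=> clC; have [->|/set0P C0] := eqVneq C set0.
    by rewrite preimage_set0 setI0.
  have mdist (g : T -> 'rV[R]_l) : measurable_fun D (g : T -> borel 'rV[R]_l) ->
      measurable_fun D (dist_set C \o g).
    move=> mg; apply: (measurability _ (RGenOInfty.measurableE R)) => //.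
    move=> _ [_ [a ->] <-].
    rewrite comp_preimage; apply: mg => //; apply: borel_open.
    have dc : continuous (dist_set C).
      move=> x; apply/(@cvgrPdist_lt _ _ _ (nbhs x)) => e e0.
      apply/nbhs_ballP; exists e => //= y.
      by rewrite -ball_normE /=; apply: le_lt_trans; exact: dist_set_lipschitz.
    by apply: open_comp; [move=> x _; exact: dc|exact: interval_open].
  have mf0 : measurable_fun D (dist_set C \o f).
    apply: (measurable_fun_cvg (h := fun m => dist_set C \o f_ m)) => [m|x Dx].
      exact: mdist.
    apply/cvgrPdist_lt => e e0; have /cvgrPdist_lt /(_ _ e0) := ff _ Dx.
    by apply: filterS => m /=; apply: le_lt_trans; exact: dist_set_lipschitz.
  rewrite (_ : _ `&` _ = D `&` (dist_set C \o f) @^-1` [set 0]).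
    exact: mf0.
  by apply/seteqP; split => t [Dt /= ft]; split => //=; apply/(dist_set_eq0 _ clC C0).
apply: (@measurability _ _ T (borel 'rV[R]_l) D f (@open 'rV[R]_l)) => // _ [U oU <-].
rewrite (_ : _ `&` _ = D `\` (D `&` f @^-1` (~` U))).
  by apply: measurableD => //; apply: mclosed; rewrite closedC.
apply/seteqP; split=> t [Dt /= Ut]; split => //; first by case.
by apply: contrapT => nU; apply: Ut.
Qed.

End borel_facts.

Section baire.
Context {R : realType} {k l : nat}.
Variables (D : set 'rV[R]_k) (A : set 'rV[R]_l).
Hypotheses (cD : compact D) (cA : compact A) (A0 : A !=set0) (vA : convex_set A).
Implicit Types (f g h : 'rV[R]_k -> 'rV[R]_l) (S : set 'rV[R]_k).

(** All Baire classes at once, for functions considered on [D] with values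
    in [A]. *)
Inductive baire : ('rV[R]_k -> 'rV[R]_l) -> Prop :=
| baire_continuous f :
    (forall t, D t -> A (f t)) -> {within D, continuous f} -> baire f
| baire_limit (f_ : nat -> 'rV[R]_k -> 'rV[R]_l) f : (forall m, baire (f_ m)) ->
    (forall t, D t -> A (f t)) ->
    (forall t, D t -> f_ m t @[m --> \oo] --> f t) -> baire f.

Lemma baire_range f : baire f -> forall t, D t -> A (f t).
Proof. by case. Qed.

Lemma baire_measurable f : baire f ->
  measurable_fun (D : set (borel 'rV[R]_k)) (f : borel 'rV[R]_k -> borel 'rV[R]_l).
Proof.
have mD := borel_compact cD.
elim=> {f} [f _ fc|f_ f _ mf_ _ ff]; first exact: continuous_borel.
exact: (borel_measurable_limit mD mf_ ff).
Qed.

Definition blend (c : 'rV[R]_k -> R) f g t := f t + c t *: (g t - f t).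

Lemma blend_range (c : 'rV[R]_k -> R) f g : (forall t, 0 <= c t <= 1) ->
  (forall t, D t -> A (f t)) -> (forall t, D t -> A (g t)) ->
  forall t, D t -> A (blend c f g t).
Proof. by move=> c01 Af Ag t Dt; apply: convexE => //; [exact: Af|exact: Ag]. Qed.

Lemma baire_blend (c : 'rV[R]_k -> R) f g : continuous c -> (forall t, 0 <= c t <= 1) ->
  baire f -> baire g -> baire (blend c f g).
Proof.
move=> cc c01 + bg; elim=> {f} [f Af fc|f_ f _ bf_ Af ff]; last first.
  apply: (baire_limit bf_); first exact: blend_range (baire_range bg).
  move=> t Dt; apply: cvgD; first exact: ff.
  by apply: cvgZl_tmp; apply: cvgB; [exact: cvg_cst|exact: ff].
elim: bg => {g} [g Ag gc|g_ g _ bg_ Ag gg]; last first.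
  apply: (baire_limit bg_); first exact: blend_range.
  move=> t Dt; apply: cvgD; first exact: cvg_cst.
  by apply: cvgZl_tmp; apply: cvgB; [exact: gg|exact: cvg_cst].
apply: baire_continuous; first exact: blend_range.
move=> t; apply: cvgD; first exact: fc.
apply: cvgZ; last by apply: cvgB; [exact: gc|exact: fc].
exact: (continuous_subspaceT cc).
Qed.

Let splice S f g t := if `[< S t >] then f t else g t.

(** For a fixed set, ask that splicing along it preserve the class: the sets with
    this property form a sigma-algebra, which contains the open sets. *)
Lemma baire_splice S f g : measurable (S : set (borel 'rV[R]_k)) ->
  baire f -> baire g -> baire (splice S f g).
Proof.
pose G : set (set 'rV[R]_k) :=
  [set S | forall f g, baire f -> baire g -> baire (splice S f g)].
suff : <<s open >> `<=` G by move=> GS mS; exact: GS.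
apply: smallest_sub; first split.
- move=> f' g' _ bg; rewrite (_ : splice _ _ _ = g')//.
  by apply/funext => t; rewrite /splice asboolF.
- move=> X GX f' g' bf bg; rewrite (_ : splice _ _ _ = splice X g' f'); first exact: GX.
  apply/funext => t; rewrite /splice; case: (pselect (X t)) => Xt.
    by rewrite (asboolT Xt) asboolF//= => -[_].
  by rewrite (asboolF Xt) asboolT.
- move=> F GF f' g' bf bg.
  (* Splicing along the first [m] sets; eventually constant at each point. *)
  pose g_ := fix g_ m := if m is m'.+1 then splice (F m') f' (g_ m') else g'.
  have bg_ m : baire (g_ m) by elim: m => //= m IH; exact: GF.
  have g_E m t : (exists2 j, (j < m)%N & F j t) -> g_ m t = f' t.
    elim: m => [[]//|m IH [j jm Fj]] /=; rewrite /splice.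
    case: asboolP => // nF; apply: IH; exists j => //.
    by move: jm; rewrite ltnS leq_eqVlt => /predU1P[jm|//]; rewrite jm in Fj.
  have g_N m t : (forall j, ~ F j t) -> g_ m t = g' t.
    by move=> nF; elim: m => //= m IH; rewrite /splice asboolF.
  apply: (baire_limit bg_) => [t Dt|t Dt].
    by rewrite /splice; case: asboolP => _; [exact: (baire_range bf)|exact: (baire_range bg)].
  rewrite /splice; case: asboolP => [[j _ Fj]|nF].
    apply: cvg_near_cst; exists j.+1 => // m /= jm.
    by apply: g_E; exists j.
  apply: cvg_near_cst; apply: nearW => m; apply: g_N => j Fj.
  by apply: nF; exists j.
move=> U oU f' g' bf bg.
have [UT|/set0P C0] := eqVneq (~` U) set0.
  rewrite (_ : splice _ _ _ = f')//; apply/funext => t.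
  rewrite /splice asboolT//; apply: contrapT => nU.
  by have : (~` U) t by []; rewrite UT.
have clU : closed (~` U) by rewrite closedC.
(* The indicator of [U] is the limit of these continuous weights. *)
pose c m (t : 'rV[R]_k) := Num.min 1 (m%:R * dist_set (~` U) t).
have c01 m t : 0 <= c m t <= 1.
  by rewrite /c le_min ler01 ge_min lexx andbT mulr_ge0// dist_set_ge0.
have cc m : continuous (c m).
  move=> t; apply: (@continuous_min _ _ (fun=> 1) (fun t => m%:R * dist_set (~` U) t)).
    exact: cst_continuous.
  apply/(@cvgrPdist_lt _ _ _ (nbhs t)) => e e0.
  apply/nbhs_ballP; exists (e / m.+1%:R) => /=; first by rewrite divr_gt0.
  move=> y; rewrite -ball_normE /= ltr_pdivlMr// => ty.
  rewrite -mulrBr normrM ger0_norm// mulrC; apply: le_lt_trans ty.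
  by apply: ler_pM => //; [exact: dist_set_lipschitz|rewrite ler_nat].
apply: (baire_limit (f_ := fun m => blend (c m) g' f')) => [m|t Dt|t Dt].
- exact: baire_blend.
- by rewrite /splice; case: asboolP => _; [exact: (baire_range bf)|exact: (baire_range bg)].
- rewrite /splice; case: asboolP => Ut; last first.
    apply: cvg_near_cst; apply: nearW => m; rewrite /blend /c.
    rewrite (iffRL (dist_set_eq0 _ clU C0) Ut) mulr0 min_r ?ler01//.
    by rewrite scale0r addr0.
  have d0 : 0 < dist_set (~` U) t.
    rewrite lt_neqAle dist_set_ge0// andbT eq_sym; apply/eqP => d0.
    by have := iffLR (dist_set_eq0 _ clU C0) d0.
  apply: cvg_near_cst.
  exists (Num.bound (dist_set (~` U) t)^-1) => // m /= bm; rewrite /blend /c.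
  have m1 : 1 <= m%:R * dist_set (~` U) t.
    rewrite -ler_pdivrMr// div1r; apply: (@le_trans _ _ (Num.bound (dist_set (~` U) t)^-1)%:R).
      by apply: ltW; apply: archi_boundP; rewrite invr_ge0 ltW.
    by rewrite ler_nat.
  by rewrite min_l// scale1r addrC subrK.
Qed.

(** A measurable strategy is the limit of its roundings to finite nets of [A]. *)
Lemma measurable_baire f : (forall t, D t -> A (f t)) ->
  measurable_fun (D : set (borel 'rV[R]_k)) (f : borel 'rV[R]_k -> borel 'rV[R]_l) ->
  baire f.
Proof.
move=> Af mf; have mD := borel_compact cD; have [a0 Aa0] := A0.
have rounding (e : R) : 0 < e -> exists2 g, baire g & forall t, D t -> `|f t - g t| < e.
  move=> e0; have [s [sA sn]] := finite_net cA e0.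
  suff [g bg Hg] : exists2 g, baire g & forall t, D t ->
      (exists2 a, a \in s & `|a - f t| < e) -> `|f t - g t| < e.
    by exists g => // t Dt; apply: Hg => //; apply: sn; exact: Af.
  elim: s sA {sn} => [|a s IH] sA.
    exists (fun=> a0) => [|t Dt [a]]; last by rewrite in_nil.
    by apply: baire_continuous => // t; exact: cvg_cst.
  have [|g bg Hg] := IH; first by move=> x xs; apply: sA; rewrite inE xs orbT.
  pose S := D `&` f @^-1` (ball a e).
  exists (splice S (fun=> a) g) => [|t Dt [b]].
    apply: baire_splice => //.
      by apply: mf => //; apply: borel_open; exact: ball_open.
    apply: baire_continuous => [t Dt|t]; last exact: cvg_cst.
    by apply: sA; rewrite mem_head.
  rewrite /splice; case: asboolP => [[_ /=]|nS].
    by rewrite -ball_normE /= distrC.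
  rewrite inE => /predU1P[-> ae|bs be]; last by apply: Hg => //; exists b.
  by exfalso; apply: nS; split => //=; rewrite -ball_normE.
have rnd m : exists g, baire g /\ forall t, D t -> `|f t - g t| < m.+1%:R^-1.
  by have [|g bg Hg] := rounding m.+1%:R^-1; [rewrite invr_gt0|exists g].
have [f_ Hf_] := choice rnd.
apply: (baire_limit (f_ := f_)) => [m||t Dt] //; first by have [] := Hf_ m.
apply/cvgrPdist_lt => e e0; near=> m.
have [_ /(_ _ Dt) h] := Hf_ m; apply: (lt_trans h).
near: m; exact: near_infty_natSinv_lt (PosNum e0).
Unshelve. all: by end_near.
Qed.

End baire.

(** * Bounded integrals *)

Section bounded_integral.
Context {d : measure_display} {T : measurableType d} {R : realType}.
Variables (P : probability T R) (D : set T).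
Hypothesis mD : measurable D.

Lemma bounded_integrable (f : T -> R) C : measurable_fun D f ->
  (forall t, D t -> `|f t| <= C) -> P.-integrable D (EFin \o f).
Proof.
move=> mf fC; apply: measurable_bounded_integrable => //.
  by rewrite (le_lt_trans (probability_le1 _ _))// ltry.
exists C; split; first exact: num_real.
by move=> C' CC' t Dt /=; rewrite (le_trans (fC _ Dt))// ltW.
Qed.

Lemma integrable_sumr (I : Type) (r : seq I) (f : I -> T -> R) :
  (forall i, P.-integrable D (EFin \o f i)) ->
  P.-integrable D (EFin \o (fun t => \sum_(i <- r) f i t)).
Proof.
move=> fi; have := integrable_sum mD r (P := xpredT) (fun i _ => fi i).
by congr (_.-integrable _ _); apply/funext => t /=; rewrite sumEFin.
Qed.

Lemma Rintegral_sumr (I : Type) (r : seq I) (f : I -> T -> R) :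
  (forall i, P.-integrable D (EFin \o f i)) ->
  \int[P]_(t in D) (\sum_(i <- r) f i t) = \sum_(i <- r) \int[P]_(t in D) f i t.
Proof.
move=> fi; elim: r => [|i r IH].
  under eq_Rintegral do rewrite big_nil.
  by rewrite big_nil Rintegral_cst// mul0r.
under eq_Rintegral do rewrite big_cons.
by rewrite big_cons RintegralD ?IH//; exact: integrable_sumr.
Qed.

Lemma Rintegral_le_cst (f : T -> R) C : 0 <= C -> P.-integrable D (EFin \o f) ->
  (forall t, D t -> f t <= C) -> \int[P]_(t in D) f t <= C.
Proof.
move=> C0 fi fC.
apply: (@le_trans _ _ (\int[P]_(t in D) C)).
  apply: le_Rintegral => //; apply: (@bounded_integrable _ `|C|) => //.
rewrite Rintegral_cst// ler_piMr//.
by rewrite -lee_fin fineK ?fin_num_measure// probability_le1.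
Qed.

Lemma bounded_convergence (f_ : nat -> T -> R) (f : T -> R) C :
  (forall m, measurable_fun D (f_ m)) ->
  (forall m t, D t -> `|f_ m t| <= C) ->
  (forall t, D t -> f_ m t @[m --> \oo] --> f t) ->
  \int[P]_(t in D) f_ m t @[m --> \oo] --> \int[P]_(t in D) f t.
Proof.
move=> mf_ fC ff.
have mf : measurable_fun D f by exact: measurable_fun_cvg mf_ ff.
have fC' t : D t -> `|f t| <= C.
  move=> Dt; apply: (cvgr_to_le (cvg_norm (ff _ Dt))).
  by apply: nearW => m; exact: fC.
have fi : P.-integrable D (EFin \o f) by exact: bounded_integrable fC'.
apply: fine_cvg; rewrite fineK; last exact: integrable_fin_num.
apply: (dominated_cvg mD (g := cst C%:E)) => //.
- by move=> m; exact/measurable_EFinP.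
- by move=> t Dt; apply: cvg_EFin; [exact: nearW|exact: ff].
- exact: (@bounded_integrable (cst C) `|C|).
Qed.

End bounded_integral.

(** * Discretisation of functions of the type profile *)

Section discretisation.
Context {R : realType} {n : nat} {d : 'I_n -> nat}.
Variable X : forall i, set 'rV[R]_(d i).
Arguments X : clear implicits.

Local Notation types_profile := (forall i, 'rV[R]_(d i)).

(** Uniform approximation by step functions on products of Borel sets, encoded by
    the partitions alone; the values of the step functions can be read off. *)
Definition discretizable (F : types_profile -> R) :=
  forall e : R, 0 < e -> exists (L : 'I_n -> finType)
      (c : forall j, 'rV[R]_(d j) -> L j),
    (forall j l, measurable (X j `&` [set t | c j t = l] : set (borel 'rV[R]_(d j)))) /\
    forall th th', box X th -> box X th' ->
      (forall j, c j (th j) = c j (th' j)) -> `|F th - F th'| <= e.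

Lemma discretizableB F F' : discretizable F -> discretizable F' ->
  discretizable (fun th => F th - F' th).
Proof.
move=> dF dF' e e0; have e2 : 0 < e / 2 by exact: divr_gt0.
have [L [c [mc Hc]]] := dF _ e2; have [L' [c' [mc' Hc']]] := dF' _ e2.
exists (fun j => (L j * L' j)%type : finType), (fun j t => (c j t, c' j t)).
split=> [j [l l']|th th' Xth Xth' E].
  rewrite (_ : _ `&` _ = (X j `&` [set t | c j t = l]) `&` (X j `&` [set t | c' j t = l'])).
    exact: measurableI.
  by apply/seteqP; split => [t [Xt [/= <- <-]]|t [[Xt /= <-] [_ /= <-]]].
have h : `|F th - F th'| <= e / 2 by apply: Hc => // j; have [] := E j.
have h' : `|F' th - F' th'| <= e / 2 by apply: Hc' => // j; have [] := E j.
rewrite (_ : _ - _ = (F th - F th') - (F' th - F' th')); last by ring.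
by rewrite (le_trans (ler_normB _ _))//; lra.
Qed.

Section step.
Variables (L : 'I_n -> finType) (c : forall j, 'rV[R]_(d j) -> L j).
Arguments c : clear implicits.

Definition cell (k : {dffun forall j, L j}) : set types_profile :=
  [set th | forall j, X j (th j) /\ c j (th j) = k j].

(** The value at some profile of the cell, and [0] on an empty cell. *)
Definition step_value (F : types_profile -> R) (k : {dffun forall j, L j}) : R :=
  xget 0 [set r | exists2 th, cell k th & r = F th].

Definition step (F : types_profile -> R) th : R :=
  \sum_k step_value F k * \1_(cell k) th.

Lemma step_close F e : (forall th th', box X th -> box X th' ->
    (forall j, c j (th j) = c j (th' j)) -> `|F th - F th'| <= e) ->
  forall th, box X th -> `|F th - step F th| <= e.
Proof.
move=> Fe th Xth; pose k0 : {dffun forall j, L j} := [ffun j => c j (th j)].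
have k0th : cell k0 th by move=> j; split; [exact: Xth|rewrite ffunE].
rewrite /step (bigD1 k0)//= big1 => [|k kk0]; last first.
  rewrite indicE (_ : (th \in cell k) = false) ?mulr0//.
  apply/negP; rewrite inE => kth; case/eqP: kk0; apply/ffunP => j.
  by rewrite ffunE; have [_ ->] := kth j.
rewrite addr0 indicE mem_set// mulr1 /step_value.
case: xgetP => [r _ [th' k0th' ->]|/(_ (F th))[]]; last by exists th.
apply: Fe => // [j|j]; first by have [] := k0th' j.
by have [_ ->] := k0th j; have [_ ->] := k0th' j.
Qed.

End step.

(** A cell pulls back to a finite intersection of preimages of Borel sets, hence
    to a measurable set for any sigma-algebra that makes the coordinates Borel. *)
Lemma discretizable_measurable dd (T : measurableType dd) (E : set T)
    (w : T -> types_profile) (F : types_profile -> R) :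
  measurable E -> discretizable F -> (forall t, E t -> box X (w t)) ->
  (forall j, measurable_fun E (fun t => w t j : borel 'rV[R]_(d j))) ->
  measurable_fun E (F \o w).
Proof.
move=> mE dF Xw mw.
have pos m : 0 < m.+1%:R^-1 :> R by rewrite invr_gt0.
have /choice[L HL] := fun m => dF _ (pos m).
have /(_ _)/cid-/all_sig[c Hc] := HL.
apply: (measurable_fun_cvg (h := fun m t => step (c m) F (w t))) => [m|t Et].
  apply: measurable_sum => k; apply: measurable_funM; first exact: measurable_cst.
  pose C := \bigcap_(j in setT)
    (E `&` (fun t => w t j) @^-1` (X j `&` [set t | c m j t = k j])).
  have mC : measurable (E `&` C).
    apply: measurableI => //; apply: fin_bigcap_measurable => // j _.
    by apply: mw => //; have [] := Hc m.
  apply: (eq_measurable_fun (\1_(E `&` C) : T -> R)); last exact: measurable_indic.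
  move=> t /set_mem Et; rewrite !indicE; congr (nat_of_bool _)%:R.
  apply/idP/idP; rewrite !inE.
    by move=> [_ Ct] j; have [_ []] := Ct j I.
  by move=> kt; split => // j _; split => //; have [] := kt j.
apply/cvgrPdist_lt => e e0; near=> m.
apply: (le_lt_trans (step_close (proj2 (Hc m)) (Xw _ Et))).
near: m; exact: near_infty_natSinv_lt (PosNum e0).
Unshelve. all: by end_near.
Qed.

End discretisation.

(** * Finite partitions from nets *)

Section cells.
Context {R : realType}.

Lemma measurable_find k l (D : set 'rV[R]_k) (g : 'rV[R]_k -> 'rV[R]_l)
    (s : seq 'rV[R]_l) (e : R) m :
  measurable (D : set (borel 'rV[R]_k)) ->
  measurable_fun (D : set (borel 'rV[R]_k)) (g : borel 'rV[R]_k -> borel 'rV[R]_l) ->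
  measurable (D `&` [set t | find (fun x => `|x - g t| < e) s = m] : set (borel 'rV[R]_k)).
Proof.
move=> mD mg; elim: s m => [|a s IH] m.
  case: m => [|m]; first by rewrite (_ : [set t | _] = setT) ?setIT//; apply/seteqP; split.
  by rewrite (_ : [set t | _] = set0) ?setI0//; apply/seteqP; split.
have mS : measurable (D `&` g @^-1` ball a e : set (borel 'rV[R]_k)).
  by apply: mg => //; apply: borel_open; exact: ball_open.
case: m => [|m].
  rewrite (_ : _ `&` _ = D `&` g @^-1` ball a e)//.
  by apply/seteqP; split=> t [Dt] /=; rewrite -ball_normE /=; case: ifP => // _ _; split.
rewrite (_ : _ `&` _ = (D `&` [set t | find (fun x => `|x - g t| < e) s = m]) `\`
    (D `&` g @^-1` ball a e)); first exact: measurableD.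
apply/seteqP; split=> t /=; rewrite -ball_normE /=; case: ifP => at_.
- by move=> [].
- by move=> [Dt [E]]; split => // -[].
- by move=> [[Dt _] /(_ (conj Dt isT))].
- by move=> [[Dt ->]].
Qed.

(** Label a point by the first net point close to its image. *)
Lemma net_label k l (D : set 'rV[R]_k) (A : set 'rV[R]_l) (g : 'rV[R]_k -> 'rV[R]_l) (e : R) :
  measurable (D : set (borel 'rV[R]_k)) ->
  measurable_fun (D : set (borel 'rV[R]_k)) (g : borel 'rV[R]_k -> borel 'rV[R]_l) ->
  compact A -> (forall t, D t -> A (g t)) -> 0 < e ->
  exists (L : finType) (c : 'rV[R]_k -> L),
    (forall x, measurable (D `&` [set t | c t = x] : set (borel 'rV[R]_k))) /\
    forall t t', D t -> D t' -> c t = c t' -> `|g t - g t'| <= e.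
Proof.
move=> mD mg cA Ag e0; have e2 : 0 < e / 2 by exact: divr_gt0.
have [s [sA sn]] := finite_net cA e2.
pose p t := fun x : 'rV[R]_l => `|x - g t| < e / 2.
(* [find] returns [size s] when no net point is close, hence one extra label. *)
exists 'I_(size s).+1, (fun t => inord (find (p t) s)); split=> [x|t t' Dt Dt'].
  rewrite (_ : _ `&` _ = D `&` [set t | find (p t) s = x]); first exact: measurable_find.
  apply/seteqP; split=> t [Dt /= E]; split => //=.
    by rewrite -E inordK// ltnS find_size.
  by apply/val_inj; rewrite /= -E inordK// ltnS find_size.
move=> /(congr1 val); rewrite /= !inordK ?ltnS ?find_size// => E.
have hasp u : D u -> has (p u) s.
  by move=> Du; apply/hasP; have [x xs xu] := sn _ (Ag _ Du); exists x.
have := nth_find 0 (hasp _ Dt); have := nth_find 0 (hasp _ Dt'); rewrite -E.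
set a := nth _ _ _; rewrite /p => h1 h2.
have -> : g t - g t' = - (a - g t) + (a - g t') by rewrite opprB addrA subrK.
by rewrite (le_trans (ler_normD _ _))// normrN; lra.
Qed.

End cells.

(** * From conditional to prior expectations *)

Section mixing.
Context {n : nat}.

Lemma mix_comp (T T' : 'I_n -> Type) (i : 'I_n) (y : T i -> T' i)
    (f : forall j : others i, T (sval j) -> T' (sval j)) (t : T i)
    (s : forall j : others i, T (sval j)) :
  (fun j => mix (T := fun j => T j -> T' j) y f j (mix t s j)) =
  mix (y t) (fun j => f j (s j)).
Proof.
apply: functional_extensionality_dep => j; have [ji|ji] := eqVneq j i.
  by case: _ / (esym ji) in t s y f *; rewrite !mix_self.
have -> : j = sval (exist (fun j => is_true (j != i)) j ji) by [].
by rewrite !mix_other.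
Qed.

End mixing.

Section disintegration.
Context {R : realType} {n : nat} {d z : 'I_n -> nat} (G : bayesian_game R d z).
Hypothesis cX : forall i, compact (types G i).
Let X := types G.
Arguments X : clear implicits.

Let mX i : measurable (X i : set (borel 'rV[R]_(d i))).
Proof. exact: borel_compact. Qed.
Arguments mX : clear implicits.

Lemma coord_measurable (E : set (profile R d)) j : measurable E ->
  measurable_fun E (fun th => th j : borel 'rV[R]_(d j)).
Proof.
move=> mE; apply: (@measurable_funS _ _ _ _ setT) => //.
apply: (@measurability _ _ (profile R d) (borel 'rV[R]_(d j)) setT _ (@open 'rV[R]_(d j))) => //.
move=> _ [U oU <-]; rewrite setTI; apply: sub_sigma_algebra.
apply: (@open_comp (prod_topology (fun i => 'rV[R]_(d i))) _ (fun th => th j)) => // th _.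
exact: (@proj_continuous 'I_n (fun i => 'rV[R]_(d i)) j).
Qed.

Lemma coord_but_measurable i (E : set (profile_but R d i)) j : measurable E ->
  measurable_fun E (fun s => s j : borel 'rV[R]_(d (sval j))).
Proof.
move=> mE; apply: (@measurable_funS _ _ _ _ setT) => //.
apply: (@measurability _ _ (profile_but R d i) (borel 'rV[R]_(d (sval j))) setT _
  (@open 'rV[R]_(d (sval j)))) => //.
move=> _ [U oU <-]; rewrite setTI; apply: sub_sigma_algebra.
apply: (@open_comp (prod_topology (fun j : others i => 'rV[R]_(d (sval j)))) _
  (fun th => th j)) => // th _.
exact: (@proj_continuous (others i) (fun j => 'rV[R]_(d (sval j))) j).
Qed.

Lemma mix_measurable i (E : set (profile_but R d i)) t j : measurable E ->
  measurable_fun E (fun s => mix t s j : borel 'rV[R]_(d j)).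
Proof.
move=> mE; have [ji|ji] := eqVneq j i.
  subst j; rewrite (_ : (fun s => _) = cst t); first exact: measurable_cst.
  by apply/funext => s; rewrite mix_self.
rewrite (_ : (fun s => _) = fun s : profile_but R d i => s (exist _ j ji)).
  exact: (@coord_but_measurable i E (exist _ j ji) mE).
by apply/funext => s; rewrite -(mix_other t s).
Qed.

Lemma box_measurable : measurable (box X : set (profile R d)).
Proof.
rewrite (_ : box X = \bigcap_(j in setT) (setT `&` (fun th : profile R d => th j) @^-1` X j)).
  apply: fin_bigcap_measurable => // j _; exact: coord_measurable.
by apply/seteqP; split => [th Xth j _|th Xth j]; [split=> //; exact: Xth|have [] := Xth j I].
Qed.

Lemma box_but_measurable i : measurable (box_but X i : set (profile_but R d i)).
Proof.
rewrite (_ : box_but X i =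
    \bigcap_(j in setT) (setT `&` (fun th : profile_but R d i => th j) @^-1` X (sval j))).
  apply: fin_bigcap_measurable => [|j _]; first exact: finite_finset.
exact: coord_but_measurable.
by apply/seteqP; split => [th Xth j _|th Xth j]; [split=> //; exact: Xth|have [] := Xth j I].
Qed.

Arguments box_but_measurable : clear implicits.

Lemma box_mix i t s : X i t -> box_but X i s -> box X (mix t s).
Proof.
Proof.
move=> Xt Xs j; have [ji|ji] := eqVneq j i.
  by subst j; rewrite mix_self.
by have -> : j = sval (exist (fun j => is_true (j != i)) j ji) by []; rewrite mix_other.
Qed.

(** The tower property, as far as it concerns signs.  On a step function, whose
    cells are rectangles in the type of [i] and the types of the others, it is
    the defining property of the conditional distributions, and step functions
    approximate [F] uniformly. *)
Lemma prior_integral_le0 i (F : (forall j, 'rV[R]_(d j)) -> R) C :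
  discretizable X F -> (forall th, box X th -> `|F th| <= C) ->
  (forall t, X i t -> \int[cond G i t]_(s in box_but X i) F (mix t s) <= 0) ->
  \int[prior G]_(th in box X) F th <= 0.
Proof.
move=> dF FC Fcond.
have mF : measurable_fun (box X : set (profile R d)) F.
  apply: (@discretizable_measurable R n d X _ (profile R d) (box X) (fun th => th) F
    box_measurable dF) => // j.
  by apply: coord_measurable; exact: box_measurable.
have mFt t : X i t -> measurable_fun (box_but X i : set (profile_but R d i)) (fun s => F (mix t s)).
  move=> Xt; apply: (@discretizable_measurable R n d X _ (profile_but R d i)
    (box_but X i) (fun s => mix t s) F (box_but_measurable i) dF) => [s|j].
    exact: box_mix.
  by apply: mix_measurable; exact: box_but_measurable.
apply/ler_addgt0Pr => e0 e0gt; rewrite add0r.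
pose e := e0 / 2; have e_gt0 : 0 < e by exact: divr_gt0.
have [L [c [mc /step_close close]]] := dF _ e_gt0.
pose v := step_value X c F.
pose T (k : {dffun forall j, L j}) : set (borel 'rV[R]_(d i)) := X i `&` [set t | c i t = k i].
pose S (k : {dffun forall j, L j}) : set (profile_but R d i) :=
  [set s | forall j, X (sval j) (s j) /\ c (sval j) (s j) = k (sval j)].
have mT (k : {dffun forall j, L j}) : measurable (T k) by exact: mc.
have mS (k : {dffun forall j, L j}) : measurable (S k).
  rewrite (_ : S k = \bigcap_(j in setT) (setT `&` (fun s : profile_but R d i => s j) @^-1`
     (X (sval j) `&` [set t | c (sval j) t = k (sval j)]))).
    apply: fin_bigcap_measurable => [|j _]; first exact: finite_finset.
    exact: coord_but_measurable.
  by apply/seteqP; split => [s Ss j _|s Ss j]; [split=> //; exact: Ss|have [] := Ss j I].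
have cellE (k : {dffun forall j, L j}) :
    cell X c k = [set th : profile R d | T k (th i) /\ S k (but i th)].
  apply/seteqP; split=> [th kth|th [Tk Sk] j].
    by split; [exact: kth|move=> j; exact: kth].
  have [->|ji] := eqVneq j i; first exact: Tk.
  exact: (Sk (exist _ j ji)).
have cell_box (k : {dffun forall j, L j}) : cell X c k `<=` box X.
  by move=> th kth j; have [] := kth j.
pose W : set (profile R d) := [set th | X i (th i)].
have mW : measurable W.
  rewrite (_ : W = setT `&` (fun th : profile R d => th i) @^-1` X i) ?setTI//.
  by rewrite -[X in measurable X]setTI; exact: coord_measurable.
have mWT (k : {dffun forall j, L j}) : measurable ([set th | T k (th i)] : set (profile R d)).
  by rewrite -[X in measurable X]setTI; exact: coord_measurable.
have mcell (k : {dffun forall j, L j}) : measurable (cell X c k : set (profile R d)).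
  rewrite (_ : cell X c k = \bigcap_(j in setT) (setT `&` (fun th : profile R d => th j) @^-1`
     (X j `&` [set t | c j t = k j]))).
    by apply: fin_bigcap_measurable => // j _; exact: coord_measurable.
  by apply/seteqP; split => [th kth j _|th kth j]; [split=> //; exact: kth|have [] := kth j I].
pose p (k : {dffun forall j, L j}) (th : profile R d) : R := fine (cond G i (th i) (S k)).
have p01 (k : {dffun forall j, L j}) th : 0 <= p k th <= 1.
  rewrite /p fine_ge0//= -lee_fin fineK ?fin_num_measure//.
  exact: probability_le1.
have mp (k : {dffun forall j, L j}) : measurable_fun W (p k).
  have WX : [set th i | th in W] `<=` X i by move=> _ [th Wth <-].
  have mcW := measurable_comp (mX i) WX (measurable_cond _ _ _ _ G i _ (mS k)).
  exact: (measurableT_comp (fine_measurable measurableT) (mcW (coord_measurable mW))).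
pose q (k : {dffun forall j, L j}) := p k \_ [set th | T k (th i)].
have q01 (k : {dffun forall j, L j}) th : `|q k th| <= 1.
  rewrite /q /restrict; case: ifP => _; last by rewrite normr0.
  by have /andP[? ?] := p01 k th; rewrite ger0_norm.
have mq (k : {dffun forall j, L j}) : measurable_fun W (q k).
  by apply/measurable_restrict => //; apply: measurable_funS (mp k) => //.
have iq (k : {dffun forall j, L j}) : (prior G).-integrable W (EFin \o q k).
  by apply: (bounded_integrable _ mW (C := 1)).
have prior_cell (k : {dffun forall j, L j}) :
    fine (prior G (cell X c k)) = \int[prior G]_(th in W) q k th.
  rewrite -Rintegral_mkcondr cellE condE// /Rintegral; congr fine.
  apply: eq_integral => th _; rewrite /p fineK ?fin_num_measure//.
have indic_int (k : {dffun forall j, L j}) : (prior G).-integrable (box X : set (profile R d))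
    (EFin \o (fun th => v k * \1_(cell X c k) th)).
  apply: (bounded_integrable _ box_measurable (C := `|v k|)).
    by apply: measurable_funM; [exact: measurable_cst|exact: measurable_indic].
  move=> th _; rewrite normrM ler_piMr// indicE; case: (_ \in _); by rewrite ?normr1 ?normr0.
(* Both sides are the prior integral of the conditional expectation of the step
   function given the type of [i]. *)
have step_prior : \int[prior G]_(th in box X) step X c F th =
    \int[prior G]_(th in W) (\sum_k v k * q k th).
  rewrite /step (Rintegral_sumr box_measurable)//.
  rewrite (Rintegral_sumr mW)//; last first.
    move=> k; apply: (bounded_integrable _ mW (C := `|v k|)).
      by apply: measurable_funM; [exact: measurable_cst|exact: mq].
    by move=> th _; rewrite normrM ler_piMr.
  apply: eq_bigr => k _; rewrite (RintegralZl _ box_measurable).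
    rewrite (RintegralZl _ mW)// -prior_cell; congr (_ * _).
    by rewrite /Rintegral (integral_indic _ box_measurable)// setIidl.
  apply: (bounded_integrable _ box_measurable (C := 1)); first exact: measurable_indic.
  by move=> th _; rewrite indicE; case: (_ \in _); rewrite ?normr1 ?normr0.
have step_cond th : W th -> \sum_k v k * q k th <= e.
  move=> Wth; set t := th i in Wth *.
  have sE s : step X c F (mix t s) = \sum_k (v k * \1_(T k) t) * \1_(S k) s.
    apply: eq_bigr => k _; rewrite -mulrA; congr (_ * _).
    rewrite !indicE -natrM mulnb; congr (nat_of_bool _)%:R.
    have bE : but i (mix t s) = s.
      by apply: functional_extensionality_dep => j; rewrite /but mix_other.
    rewrite cellE; apply/idP/andP; rewrite !inE /= mix_self bE => -[//].
  have iS (k : {dffun forall j, L j}) :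
      (cond G i t).-integrable (box_but X i : set (profile_but R d i))
      (EFin \o (\1_(S k) : _ -> R)).
    apply: (bounded_integrable _ (box_but_measurable i) (C := 1)); first exact: measurable_indic.
    by move=> s _; rewrite indicE; case: (_ \in _); rewrite ?normr1 ?normr0.
  have iS' (k : {dffun forall j, L j}) :
      (cond G i t).-integrable (box_but X i : set (profile_but R d i))
      (EFin \o (fun s => v k * \1_(T k) t * \1_(S k) s)).
    apply: (bounded_integrable _ (box_but_measurable i) (C := `|v k * \1_(T k) t|)).
      by apply: measurable_funM; [exact: measurable_cst|exact: measurable_indic].
    move=> s _; rewrite normrM ler_piMr// indicE; case: (_ \in _); by rewrite ?normr1 ?normr0.
  have -> : \sum_k v k * q k th =
      \int[cond G i t]_(s in box_but X i) step X c F (mix t s).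
    under [RHS]eq_Rintegral do rewrite sE.
    rewrite (Rintegral_sumr (box_but_measurable i))//.
    apply: eq_bigr => k _; rewrite (RintegralZl _ (box_but_measurable i))//.
    rewrite -mulrA; congr (_ * _).
    rewrite /Rintegral (integral_indic _ (box_but_measurable i))// setIidl; last first.
      by move=> s Ss j; exact: (Ss j).1.
    rewrite /q /restrict indicE (_ : (th \in _) = (t \in T k)); last first.
      by apply/idP/idP; rewrite !inE.
    by case: (t \in T k); rewrite ?mul1r ?mul0r.
  have iF : (cond G i t).-integrable (box_but X i : set (profile_but R d i))
      (EFin \o (fun s => F (mix t s))).
    apply: (bounded_integrable _ (box_but_measurable i) (C := C)); first exact: mFt.
    by move=> s Xs; apply: FC; exact: box_mix.
  apply: (@le_trans _ _ (\int[cond G i t]_(s in box_but X i) (F (mix t s) + e))).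
    apply: le_Rintegral; first exact: box_but_measurable.
    - rewrite (_ : EFin \o _ = EFin \o (fun s => \sum_k v k * \1_(T k) t * \1_(S k) s)).
        exact: (integrable_sumr (box_but_measurable i)).
      by apply/funext => s /=; rewrite sE.
    - apply: (bounded_integrable _ (box_but_measurable i) (C := C + e)).
        by apply: measurable_funD; [exact: mFt|exact: measurable_cst].
      move=> s Xs; rewrite (le_trans (ler_normD _ _))// lerD//; last by rewrite gtr0_norm.
      by apply: FC; exact: box_mix.
    - move=> s Xs; have := close _ (box_mix Wth Xs).
      by rewrite ler_norml => /andP[]; lra.
  rewrite RintegralD//; last 2 first.
  - exact: box_but_measurable.
  - by apply: (bounded_integrable _ (box_but_measurable i) (C := `|e|)).
  rewrite Rintegral_cst; last exact: box_but_measurable.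
  rewrite -[leRHS]add0r lerD//; first exact: Fcond.
  rewrite ler_piMr ?(ltW e_gt0)// -lee_fin fineK ?fin_num_measure//; last exact: box_but_measurable.
  by apply: probability_le1; exact: box_but_measurable.
apply: (@le_trans _ _ (\int[prior G]_(th in box X) (step X c F th + e))).
  apply: le_Rintegral; first exact: box_measurable.
  - by apply: (bounded_integrable _ box_measurable (C := C)).
  - rewrite (_ : EFin \o _ = (EFin \o step X c F) \+ (EFin \o cst e))%E; last first.
      by apply/funext.
    apply: integrableD; first exact: box_measurable.
      exact: (integrable_sumr box_measurable).
    by apply: (bounded_integrable _ box_measurable (C := `|e|)).
  - by move=> th Xth; have := close _ Xth; rewrite ler_norml => /andP[]; lra.
rewrite RintegralD//; last 3 first.
- exact: box_measurable.
- exact: (integrable_sumr box_measurable).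
- by apply: (bounded_integrable _ box_measurable (C := `|e|)).
rewrite Rintegral_cst; last exact: box_measurable.
have -> : e0 = e + e by rewrite /e -splitr.
apply: lerD; last first.
  rewrite ler_piMr ?(ltW e_gt0)// -lee_fin fineK ?fin_num_measure//; last exact: box_measurable.
  by apply: probability_le1; exact: box_measurable.
rewrite step_prior; apply: Rintegral_le_cst => //; first exact: ltW.
apply: (integrable_sumr mW) => k.
apply: (bounded_integrable _ mW (C := `|v k|)).
  by apply: measurable_funM; [exact: measurable_cst|exact: mq].
by move=> th _; rewrite normrM ler_piMr.
Qed.

End disintegration.

(** * Minty's inequality *)

Section minty.
Context {R : realType} {n : nat} {d z : 'I_n -> nat}.
Variables (X : forall i, set 'rV[R]_(d i)) (A : forall i, set 'rV[R]_(z i)).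
Variable w : forall i : 'I_n, 'rV[R]_(d i) -> 'rV[R]_(d i) -> R.
Arguments X : clear implicits.
Arguments A : clear implicits.
Arguments w : clear implicits.
Hypotheses (cX : forall i, compact (X i)) (cA : forall i, compact (A i)).
Hypotheses (A0 : forall i, A i !=set0) (vA : forall i, convex_set (A i)).
Hypothesis w0 : forall i t t', 0 <= w i t t'.
Hypothesis wsmall : forall i (e : R), 0 < e -> exists2 r, 0 < r &
  forall t t', X i t -> X i t' -> `|t - t'| < r -> w i t t' <= e.

Local Notation strategies := (forall i : 'I_n, 'rV[R]_(d i) -> 'rV[R]_(z i)).
Local Notation K := (equi X A w).

Variables (D : strategies -> strategies -> R) (c : R).
Hypothesis c0 : 0 <= c.
Hypothesis D_concave : forall h y y' (s : R), K h -> K y -> K y' -> 0 <= s <= 1 ->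
  D h y + s * (D h y' - D h y) <= D h (segment y y' s).
Hypothesis D_monotone : forall h y, K h -> K y -> 0 <= D h y + D y h.
Hypothesis D_lipschitz : forall h y y' e, K h -> K y -> K y' -> 0 <= e ->
  (forall j t, X j t -> `|y j t - y' j t| <= e) -> D h y - D h y' <= c * e.

Lemma equi_segment f g (s : R) : 0 <= s <= 1 -> K f -> K g -> K (segment f g s).
Proof.
move=> /andP[s0 s1] [fA fw] [gA gw]; split=> [i t|i t t' Xt Xt'].
  by apply: convexE => //; rewrite s0.
have -> : segment f g s i t - segment f g s i t' =
    (1 - s) *: (f i t - f i t') + s *: (g i t - g i t').
  by apply/rowP => j; rewrite !mxE; ring.
have s1' : 0 <= 1 - s by lra.
rewrite (le_trans (ler_normD _ _))// !normrZ (ger0_norm s0) (ger0_norm s1').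
by have := fw i t t' Xt Xt'; have := gw i t t' Xt Xt'; nra.
Qed.

(** The same [y] serves all [h]: it is the convex combination of the [g k] with
    weights [l], built one segment at a time. *)
Lemma equi_jensen m (g : 'I_m.+1 -> strategies) (l : 'I_m.+1 -> R) :
  (forall k, K (g k)) -> (forall k, 0 <= l k) -> \sum_k l k = 1 ->
  exists2 y, K y & forall h, K h -> \sum_k l k * D h (g k) <= D h y.
Proof.
elim: m g l => [|m IH] g l Kg l0 l1.
  exists (g ord0) => // h Kh.
  by move: l1; rewrite !big_ord_recl !big_ord0 !addr0 => ->; rewrite mul1r.
pose r := \sum_k l (lift ord0 k).
have r0 : 0 <= r by exact: sumr_ge0.
have lr : l ord0 = 1 - r by rewrite -l1 big_ord_recl addrK.
have [rE|rN] := eqVneq r 0.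
  exists (g ord0) => // h Kh; rewrite big_ord_recl lr rE subr0 mul1r big1 ?addr0// => k _.
  move/eqP: rE; rewrite psumr_eq0// => /allP /(_ k); rewrite mem_index_enum.
  by move=> /(_ isT) /= /eqP ->; rewrite mul0r.
have rpos : 0 < r by rewrite lt_neqAle eq_sym rN.
have [||| y' Ky' Hy'] := IH (fun k => g (lift ord0 k)) (fun k => l (lift ord0 k) / r).
- by move=> k; exact: Kg.
- by move=> k; rewrite divr_ge0.
- by rewrite -mulr_suml divff.
have r01 : 0 <= r <= 1 by rewrite r0 -subr_ge0 -lr l0.
exists (segment (g ord0) y' r); first exact: equi_segment.
move=> h Kh; apply: le_trans (D_concave Kh (Kg ord0) Ky' r01).
rewrite big_ord_recl lr.
have : r * \sum_k (l (lift ord0 k) / r) * D h (g (lift ord0 k)) <= r * D h y'.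
  by rewrite ler_pM2l//; exact: Hy'.
rewrite mulr_sumr.
have -> : \sum_k r * (l (lift ord0 k) / r * D h (g (lift ord0 k))) =
    \sum_k l (lift ord0 k) * D h (g (lift ord0 k)).
  by apply: eq_bigr => k _; field.
set S := \sum_k _; set u := D h (g ord0); set v := D h y'.
by lra.
Qed.

(** Finitely many of the inequalities [0 <= D g f] have a common solution: by
    monotonicity the matrix [D (g j) (g k)] has nonnegative symmetric part, and
    an optimal mixed strategy of the corresponding game gives the weights.
    Compactness of the class does the rest. *)
Lemma minty_solution : exists2 f, K f & forall g, K g -> 0 <= D g f.
Proof.
have /all_sig[a0 Aa0] := fun i => cid (A0 i).
have K0 : K (fun i _ => a0 i) by split => // i t t' _ _; rewrite subrr normr0.
pose J := {g : strategies | K g}.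
pose P (g : J) : set strategies := [set f | 0 <= D (sval g) f].
have [m g|f Kf Hf] := @equi_finite_intersection R n d z X A w cX cA wsmall J P.
  case: m g => [|m] g; first by exists (fun i _ => a0 i) => // -[].
  have [|l [l0 l1 Hl]] := @symmetric_game_optimal R m (fun j k => D (sval (g j)) (sval (g k))).
    by move=> j k; apply: D_monotone; exact: svalP.
  have [||| y Ky Hy] := @equi_jensen m (fun k => sval (g k)) l => //.
    by move=> k; exact: svalP.
  by exists y => // j; apply: le_trans (Hl j) (Hy _ (svalP (g j))).
exists f => // g Kg; apply/ler_addgt0Pr => e e0.
pose r := e / (c + 1).
have c1 : 0 < c + 1 by exact: ltr_wpDl.
have r0 : 0 < r by rewrite divr_gt0.
have [h Kh [/= Dh hf]] := Hf (exist _ g Kg) r r0.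
have := D_lipschitz Kg Kh Kf (ltW r0) hf.
have cr : c * r <= e by rewrite /r mulrA ler_pdivrMr// [e * _]mulrC ler_pM2r// lerDl.
have {}Dh : 0 <= D g h by [].
by set u := D g h in Dh *; set v := D g f; lra.
Qed.

End minty.

(** * Expected utilities *)

Section game.
Context {R : realType} {n : nat} {d z : 'I_n -> nat} (G : bayesian_game R d z).

Local Notation strategy := (fun i : 'I_n => 'rV[R]_(d i) -> 'rV[R]_(z i)).
Local Notation strategies := (forall i : 'I_n, 'rV[R]_(d i) -> 'rV[R]_(z i)).
Local Notation X := (types G).
Local Notation A := (actions G).

Lemma lipschitz_utility_norm : (forall i, lipschitz_utility G i) ->
  exists2 L, 0 <= L & forall i a a' th th',
    box A a -> box A a' -> box X th -> box X th' ->
    `|utility G i a th - utility G i a' th'| <=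
      L * (\sum_j `|a j - a' j| + \sum_j `|th j - th' j|).
Proof.
move=> /choice[L HL].
pose K : R := (\sum_j z j + \sum_j d j)%:R.
have enorm_sum (k : 'I_n -> nat) (x y : forall i, 'rV[R]_(k i)) :
    (forall j, (k j)%:R <= K) -> profile_edist x y <= K * \sum_j `|x j - y j|.
  move=> kK; apply: (le_trans (sqrt_sumsq_le (fun i => sqrtr_ge0 _))).
  rewrite mulr_sumr ler_sum// => j _; apply: (le_trans (enorm_le_norm _)).
  by rewrite ler_wpM2r.
have zK j : (z j)%:R <= K.
  by rewrite ler_nat (bigD1 j)//= -!addnA leq_addr.
have dK j : (d j)%:R <= K.
  by rewrite ler_nat [(\sum_j d j)%N](bigD1 j)//= addnCA leq_addr.
exists ((\sum_i `|L i|) * K) => [|i a a' th th' Aa Aa' Xth Xth'].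
  by rewrite mulr_ge0 ?ler0n ?sumr_ge0.
apply: (le_trans (HL i _ _ _ _ Aa Aa' Xth Xth')).
have sq0 k (x y : forall i, 'rV[R]_(k i)) : 0 <= profile_edist x y by exact: sqrtr_ge0.
apply: (@le_trans _ _ (`|L i| * (profile_edist a a' + profile_edist th th'))).
  apply: (@le_trans _ _ (`|L i| * Num.sqrt (profile_edist a a' ^+ 2 + profile_edist th th' ^+ 2))).
    by rewrite ler_wpM2r ?sqrtr_ge0 ?ler_norm.
  rewrite ler_wpM2l// -[leRHS]ger0_norm ?addr_ge0 ?sq0// -sqrtr_sqr ler_wsqrtr//.
  by have := sq0 _ z a a'; have := sq0 _ d th th'; nra.
rewrite -mulrA; apply: ler_pM => //; first by rewrite addr_ge0 ?sq0.
  by rewrite (bigD1 i)//= lerDl sumr_ge0.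
by rewrite mulrDr; apply: lerD; apply: enorm_sum.
Qed.

Lemma actions_diameter : (forall i, compact (A i)) ->
  exists B, forall i x y, A i x -> A i y -> `|x - y| <= B.
Proof.
move=> cA.
have /choice[M HM] : forall i, exists M, forall x, A i x -> `|x| <= M.
  move=> i; have [M [_ HM]] := compact_bounded (@cA i).
  by exists (`|M| + 1) => x Ax; apply: HM => //; rewrite ltr_pwDr// ler_norm.
exists (\sum_i 2 * `|M i|) => i x y Ax Ay.
apply: (@le_trans _ _ (2 * `|M i|)); last first.
  by rewrite (bigD1 i)//= lerDl sumr_ge0// => j _; rewrite mulr_ge0.
rewrite (le_trans (ler_normB _ _))// mulr_natl mulr2n.
by rewrite lerD// (le_trans (HM i _ _) (ler_norm _)).
Qed.

Hypotheses (cA : forall i, compact (A i)) (vA : forall i, convex_set (A i))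
  (cX : forall i, compact (X i)).
Variable L : R.
Hypotheses (L0 : 0 <= L) (uL : forall i a a' th th',
    box A a -> box A a' -> box X th -> box X th' ->
    `|utility G i a th - utility G i a' th'| <=
      L * (\sum_j `|a j - a' j| + \sum_j `|th j - th' j|)).
Hypothesis conc : forall i, concave_utility G i.

Lemma utility_bounded : exists2 C, 0 <= C & forall i a th, box A a -> box X th ->
  `|utility G i a th| <= C.
Proof.
have bnd k (S : set 'rV[R]_k) : compact S -> exists2 M, 0 <= M & forall x, S x -> `|x| <= M.
  move=> /compact_bounded[M [_ HM]]; exists (`|M| + 1); first by rewrite addr_ge0.
  by move=> x Sx; apply: HM => //; rewrite ltr_pwDr// ler_norm.
have /all_sig[a0 Aa0] := fun i => cid (actions_neq0 _ _ _ _ G i).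
have /all_sig[t0 Xt0] := fun i => cid (types_neq0 _ _ _ _ G i).
have /choice[MA HMA] : forall i, exists M, 0 <= M /\ forall x, A i x -> `|x| <= M.
  by move=> i; have [M ? ?] := bnd _ _ (@cA i); exists M.
have /choice[MX HMX] : forall i, exists M, 0 <= M /\ forall x, X i x -> `|x| <= M.
  by move=> i; have [M ? ?] := bnd _ _ (@cX i); exists M.
have MA0 i : 0 <= MA i by have [] := HMA i.
have MX0 i : 0 <= MX i by have [] := HMX i.
pose B := L * (\sum_j 2 * MA j + \sum_j 2 * MX j).
have B0 : 0 <= B.
  by rewrite mulr_ge0// addr_ge0// sumr_ge0// => j _; rewrite mulr_ge0.
exists (\sum_i `|utility G i a0 t0| + B) => [|i a th Aa Xth].
  by rewrite addr_ge0// sumr_ge0.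
rewrite -(subrK (utility G i a0 t0) (utility G i a th)) addrC.
rewrite (le_trans (ler_normD _ _))// lerD//.
  by rewrite (bigD1 i)//= lerDl sumr_ge0.
apply: (le_trans (uL i Aa Aa0 Xth Xt0)); rewrite ler_wpM2l// lerD//.
  apply: ler_sum => j _; rewrite (le_trans (ler_normB _ _))// mulr_natl mulr2n.
  by rewrite lerD// (HMA j).2.
apply: ler_sum => j _; rewrite (le_trans (ler_normB _ _))// mulr_natl mulr2n.
by rewrite lerD// (HMX j).2.
Qed.

Variable C : R.
Hypothesis uC : forall i a th, box A a -> box X th -> `|utility G i a th| <= C.

Definition profile_at (h : strategies) (th : forall i, 'rV[R]_(d i)) :
  forall i, 'rV[R]_(z i) := fun j => h j (th j).

Definition play i (h : strategies) th := utility G i (profile_at h th) th.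

Definition mstrat (h : strategies) := forall i, measurable_strat G i (h i).

Lemma mstrat_box h th : mstrat h -> box X th -> box A (profile_at h th).
Proof. by move=> mh Xth j; apply: (mh j).1; exact: Xth. Qed.

Lemma continuous_strat_measurable i f : continuous_strat G i f -> measurable_strat G i f.
Proof.
move=> [fA fc]; split => //; apply: continuous_borel => //; exact: borel_compact.
Qed.

Lemma cst_strat i a : A i a -> measurable_strat G i (fun=> a).
Proof. by move=> Aa; split => //; exact: measurable_cst. Qed.

(** Sums of Borel maps into row vectors are handled through the Baire class,
    which is closed under convex combinations by construction. *)
Lemma segment_strat i (f g : strategy i) (s : R) : 0 <= s <= 1 ->
  measurable_strat G i f -> measurable_strat G i g ->
  measurable_strat G i (fun t => f t + s *: (g t - f t)).
Proof.
move=> s01 [fA mf] [gA mg]; split=> [t Xt|].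
  by apply: convexE => //; [exact: fA|exact: gA].
apply: (baire_measurable (@cX i) (A := A i)).
apply: (baire_blend (@vA i) (c := fun=> s)) => //.
- exact: cst_continuous.
- by apply: measurable_baire => //; exact: actions_neq0.
- by apply: measurable_baire => //; exact: actions_neq0.
Qed.

Lemma mix_strat i (y : strategy i) (f : forall j : others i, strategy (sval j)) :
  measurable_strat G i y -> (forall j, measurable_strat G (sval j) (f j)) ->
  mstrat (mix y f).
Proof.
move=> my mf j; have [ji|ji] := eqVneq j i; first by subst j; rewrite mix_self.
by have -> : j = sval (exist (fun j => is_true (j != i)) j ji) by []; rewrite mix_other.
Qed.

(** Label each type by a net cell for itself and one for the action prescribed
    there; a Lipschitz utility varies little on products of such cells. *)
Lemma discretizable_play i h : mstrat h -> discretizable X (play i h).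
Proof.
move=> mh e e0.
(* The sum over the players of two variations of size [e'], times [L]. *)
pose e' := e / (L * n%:R * 2 + 1).
have den : 0 < L * n%:R * 2 + 1 by rewrite ltr_pwDr// !mulr_ge0.
have e'0 : 0 < e' by rewrite divr_gt0.
have lab j : exists (M : finType) (c : 'rV[R]_(d j) -> M),
    (forall x, measurable (X j `&` [set t | c t = x] : set (borel 'rV[R]_(d j)))) /\
    forall t t', X j t -> X j t' -> c t = c t' -> `|t - t'| <= e' /\ `|h j t - h j t'| <= e'.
  have mX : measurable (X j : set (borel 'rV[R]_(d j))) by exact: borel_compact.
  have [M [c [mc Hc]]] := net_label mX (mh j).2 (@cA j) (mh j).1 e'0.
  have [M' [c' [mc' Hc']]] :=
    @net_label R _ _ (X j) (X j) id e' mX (@measurable_id _ _ _) (@cX j) (fun t => id) e'0.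
  exists (M * M')%type, (fun t => (c t, c' t)); split=> [[x x']|t t' Xt Xt' [E E']].
    rewrite (_ : _ `&` _ = (X j `&` [set t | c t = x]) `&` (X j `&` [set t | c' t = x'])).
      exact: measurableI.
    by apply/seteqP; split => [t [Xt [/= <- <-]]|t [[Xt /= <-] [_ /= <-]]].
  by split; [exact: Hc'|exact: Hc].
have /choice[M HM] := lab; have /all_sig[c Hc] := fun j => cid (HM j).
exists M, c; split=> [j l|th th' Xth Xth' E]; first exact: (Hc j).1.
apply: (le_trans (uL i (mstrat_box mh Xth) (mstrat_box mh Xth') Xth Xth')).
apply: (@le_trans _ _ (L * (n%:R * e' + n%:R * e'))).
  rewrite ler_wpM2l// lerD//.
    apply: (@le_trans _ _ (\sum_(j < n) e')); last by rewrite sumr_const card_ord mulr_natl.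
    by apply: ler_sum => j _; exact: ((Hc j).2 _ _ (Xth j) (Xth' j) (E j)).2.
  apply: (@le_trans _ _ (\sum_(j < n) e')); last by rewrite sumr_const card_ord mulr_natl.
  by apply: ler_sum => j _; exact: ((Hc j).2 _ _ (Xth j) (Xth' j) (E j)).1.
have -> : L * (n%:R * e' + n%:R * e') = L * n%:R * 2 * e' by ring.
by rewrite /e' mulrA ler_pdivrMr// mulrC ler_pM2l//; lra.
Qed.

Lemma play_measurable i h : mstrat h ->
  measurable_fun (box X : set (profile R d)) (play i h).
Proof.
move=> mh; apply: (@discretizable_measurable R n d X _ (profile R d) (box X)
  (fun th => th) _ (box_measurable cX) (discretizable_play i mh)) => // j.
by apply: coord_measurable; exact: box_measurable.
Qed.

Lemma play_bounded i h th : mstrat h -> box X th -> `|play i h th| <= C.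
Proof. by move=> mh Xth; apply: uC => //; exact: mstrat_box. Qed.

Lemma rhoE i (y : strategy i) (f : forall j : others i, strategy (sval j)) t :
  rho G i (y t) f t = \int[cond G i t]_(s in box_but X i) play i (mix y f) (mix t s).
Proof.
by apply: eq_Rintegral => s _; rewrite /play /profile_at mix_comp.
Qed.

Lemma play_integrable_but i h (t : 'rV[R]_(d i)) : mstrat h -> X i t ->
  (cond G i t).-integrable (box_but X i : set (profile_but R d i))
    (EFin \o (fun s => play i h (mix t s))).
Proof.
move=> mh Xt; apply: (bounded_integrable _ (@box_but_measurable _ _ _ _ _ cX i) (C := C)).
  apply: (@discretizable_measurable R n d X _ (profile_but R d i)
    (box_but X i) (fun s => mix t s) _ (@box_but_measurable _ _ _ _ _ cX i)
    (discretizable_play i mh)) => [s|j]; first exact: box_mix.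
  by apply: mix_measurable; exact: box_but_measurable.
by move=> s Xs; apply: play_bounded => //; exact: box_mix.
Qed.

Definition own i (h : strategies) (th : forall i, 'rV[R]_(d i)) (x : 'rV[R]_(z i)) : R :=
  utility G i (mix x (but i (profile_at h th))) th.

Arguments own : clear implicits.

Lemma own_box i h th x : A i x -> mstrat h -> box X th ->
  box A (mix x (but i (profile_at h th))).
Proof.
move=> Ax mh Xth j; have [ji|ji] := eqVneq j i; first by subst j; rewrite mix_self.
have -> : j = sval (exist (fun j => is_true (j != i)) j ji) by [].
by rewrite mix_other; exact: (mstrat_box mh Xth).
Qed.

Lemma own_concave i h th : mstrat h -> box X th -> concave_on (A i) (own i h th).
Proof. by move=> mh Xth; apply: conc => //; exact: mstrat_box. Qed.

Lemma own_lipschitz i h th x y : mstrat h -> box X th -> A i x -> A i y ->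
  `|own i h th x - own i h th y| <= L * `|x - y|.
Proof.
move=> mh Xth Ax Ay.
apply: (le_trans (uL i (own_box Ax mh Xth) (own_box Ay mh Xth) Xth Xth)).
rewrite [X in _ + X]big1 ?addr0; last by move=> j _; rewrite subrr normr0.
rewrite (bigD1 i)//= !mix_self big1 ?addr0// => j ji.
have -> : j = sval (exist (fun j => is_true (j != i)) j ji) by [].
by rewrite !mix_other subrr normr0.
Qed.

Lemma own_play i (y : strategy i) h th :
  play i (mix y (but i h)) th = own i h th (y (th i)).
Proof.
rewrite /play /own; congr (utility G i _ th).
by rewrite /profile_at -[th in LHS](mix_but i) mix_comp.
Qed.

Lemma own_self i h th : own i h th (h i (th i)) = play i h th.
Proof. by rewrite -own_play mix_but. Qed.

Lemma rho_own i a (h : strategies) t :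
  rho G i a (but i h) t = \int[cond G i t]_(s in box_but X i) own i h (mix t s) a.
Proof.
by rewrite (rhoE (fun=> a)); apply: eq_Rintegral => s _; rewrite own_play.
Qed.

Section fixed_player.
Variables (i : 'I_n) (h : strategies).
Hypothesis mh : mstrat h.

Lemma own_integrable a t : A i a -> X i t ->
  (cond G i t).-integrable (box_but X i : set (profile_but R d i))
    (EFin \o (fun s => own i h (mix t s) a)).
Proof.
move=> Aa Xt; have mm : mstrat (mix (fun=> a) (but i h)).
  by apply: mix_strat => [|j]; [exact: cst_strat|exact: mh].
have := play_integrable_but mm Xt; congr (_.-integrable _ _).
by apply/funext => s /=; rewrite own_play.
Qed.

Lemma rho_lipschitz a b t : A i a -> A i b -> X i t ->
  rho G i a (but i h) t - rho G i b (but i h) t <= L * `|a - b|.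
Proof.
move=> Aa Ab Xt; have mB := @box_but_measurable _ _ _ _ _ cX i.
have ia := own_integrable Aa Xt; have ib := own_integrable Ab Xt.
rewrite !rho_own -(RintegralB mB ia ib).
apply: Rintegral_le_cst => //; first by rewrite mulr_ge0.
  rewrite (_ : EFin \o _ = (EFin \o (fun s => own i h (mix t s) a)) \-
      (EFin \o (fun s => own i h (mix t s) b)))%E; last exact/funext.
  exact: integrableB.
move=> s Xs; rewrite (le_trans (ler_norm _))//.
by apply: own_lipschitz => //; exact: box_mix.
Qed.

Lemma rho_concave a b t (s : R) : A i a -> A i b -> X i t -> 0 <= s <= 1 ->
  rho G i a (but i h) t + s * (rho G i b (but i h) t - rho G i a (but i h) t) <=
  rho G i (a + s *: (b - a)) (but i h) t.
Proof.
move=> Aa Ab Xt s01; have mB := @box_but_measurable _ _ _ _ _ cX i.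
have ia := own_integrable Aa Xt; have ib := own_integrable Ab Xt.
have Ac : A i (a + s *: (b - a)) by exact: convexE.
have ic := own_integrable Ac Xt.
have iba : (cond G i t).-integrable (box_but X i : set (profile_but R d i))
    (EFin \o (fun r => own i h (mix t r) b - own i h (mix t r) a)).
  rewrite (_ : EFin \o _ = (EFin \o (fun r => own i h (mix t r) b)) \-
      (EFin \o (fun r => own i h (mix t r) a)))%E; last exact/funext.
  exact: integrableB.
have isba : (cond G i t).-integrable (box_but X i : set (profile_but R d i))
    (EFin \o (fun r => s * (own i h (mix t r) b - own i h (mix t r) a))).
  rewrite (_ : EFin \o _ = (fun r => s%:E *
     (own i h (mix t r) b - own i h (mix t r) a)%R%:E))%E; last exact/funext.
  exact: integrableZl.
rewrite !rho_own -(RintegralB mB ib ia) -(RintegralZl _ mB iba) -(RintegralD mB ia isba).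
apply: le_Rintegral => //.
  rewrite (_ : EFin \o _ = (EFin \o (fun r => own i h (mix t r) a)) \+
    (EFin \o (fun r => s * (own i h (mix t r) b - own i h (mix t r) a))%R))%E; last exact/funext.
  exact: integrableD.
move=> r Xr; apply: (concaveE (A := A i)) => //.
by apply: own_concave => //; exact: box_mix.
Qed.

Lemma best_responses_neq0 t : X i t -> best_responses G i (but i h) t !=set0.
Proof.
move=> Xt; have rc : {within A i, continuous (fun a => rho G i a (but i h) t)}.
  apply/subspace_continuousP => x Ax; apply/cvgrPdist_lt => e e0.
  rewrite near_withinE; apply/nbhs_ballP; exists (e / (L + 1)) => /=.
    by rewrite divr_gt0// ltr_pwDr.
  move=> y; rewrite -ball_normE /= ltr_pdivlMr ?ltr_pwDr// => xy Ay.
  have h1 := rho_lipschitz Ax Ay Xt; have h2 := rho_lipschitz Ay Ax Xt.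
  rewrite distrC in h2; have h3 := normr_ge0 (x - y).
  by rewrite /from_subspace ltr_norml; apply/andP; split; lra.
have [a /set_mem Aa amax] := EVT_max_rV (actions_neq0 _ _ _ _ G i) (@cA i) rc.
by exists a; split => // b Ab; apply: amax; rewrite inE.
Qed.

Lemma best_responses_closed t : X i t -> closed (best_responses G i (but i h) t).
Proof.
move=> Xt a cla.
have Aa : A i a.
  apply: (compact_closed (@norm_hausdorff _ _) (@cA i)); move: a cla.
  by apply: closureS => a [].
split => // b Ab; apply/ler_addgt0Pr => e e0.
have [|c [[Ac cmax] ac]] := cla (ball a (e / (L + 1))).
  by apply: nbhsx_ballx; rewrite divr_gt0// ltr_pwDr.
have h1 := rho_lipschitz Ac Aa Xt; have h2 := cmax _ Ab.
move: ac; rewrite -ball_normE /= ltr_pdivlMr ?ltr_pwDr// distrC => ac.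
by have h3 := normr_ge0 (c - a); nra.
Qed.

Lemma best_responses_convex t : X i t -> convex_set (best_responses G i (but i h) t).
Proof.
move=> Xt a b s; rewrite !inE => -[Aa amax] [Ab bmax].
have s0 : 0 <= s%:num by []. have s1 : s%:num <= 1 by [].
have -> : conv s a b = b + s%:num *: (a - b).
  change (s%:num *: a + (1 - s%:num) *: b = b + s%:num *: (a - b)).
  by rewrite scalerBr scalerBl scale1r addrCA.
have s01 : 0 <= s%:num <= 1 by rewrite s0.
split=> [|c Ac]; first exact: convexE.
apply: le_trans (rho_concave Ab Aa Xt s01).
by have := bmax _ Aa; have := amax _ Ab; have := bmax _ Ac; nra.
Qed.

Lemma value_best_response a t : best_responses G i (but i h) t a ->
  value G i (but i h) t = rho G i a (but i h) t.
Proof.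
move=> [Aa amax]; apply/eqP; rewrite eq_le; apply/andP; split.
  by apply: ge_sup => [|_ [b Ab <-]]; [exists (rho G i a (but i h) t); exists a|exact: amax].
apply: ub_le_sup; last by exists a.
by exists (rho G i a (but i h) t) => _ [b Ab <-]; exact: amax.
Qed.

End fixed_player.

Lemma play_cvg i (h_ : nat -> strategies) h th : (forall m, mstrat (h_ m)) -> mstrat h ->
  box X th -> (forall j, h_ m j (th j) @[m --> \oo] --> h j (th j)) ->
  play i (h_ m) th @[m --> \oo] --> play i h th.
Proof.
move=> mh_ mh Xth hh.
have s0 : \sum_j `|h j (th j) - h_ m j (th j)| @[m --> \oo] --> \sum_(j < n) (0 : R).
  apply: cvg_sumr => j; rewrite -(normr0 'rV[R]_(z j)) -(subrr (h j (th j))).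
  by apply: cvg_norm; apply: cvgB; [exact: cvg_cst|exact: hh].
rewrite big1_eq in s0.
have {}s0 : L * (\sum_j `|h j (th j) - h_ m j (th j)|) @[m --> \oo] --> L * 0.
  by apply: cvgM; [exact: cvg_cst|exact: s0].
rewrite mulr0 in s0.
apply/cvgrPdist_le => e e0; have /cvgrPdist_le /(_ _ e0) := s0.
apply: filterS => m; rewrite sub0r normrN => hm; apply: le_trans hm.
rewrite (le_trans (uL i (mstrat_box mh Xth) (mstrat_box (mh_ m) Xth) Xth Xth))//.
rewrite [X in _ + X]big1 ?addr0; last by move=> j _; rewrite subrr normr0.
exact: ler_norm.
Qed.

Lemma rho_cvg i (h_ : nat -> strategies) h a t : (forall m, mstrat (h_ m)) -> mstrat h ->
  A i a -> X i t ->
  (forall j t, X j t -> h_ m j t @[m --> \oo] --> h j t) ->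
  rho G i a (but i (h_ m)) t @[m --> \oo] --> rho G i a (but i h) t.
Proof.
move=> mh_ mh Aa Xt hh.
under eq_fun do rewrite (rhoE (fun=> a)).
rewrite (rhoE (fun=> a)).
have mm k : mstrat k -> mstrat (mix (fun=> a) (but i k)).
  by move=> mk; apply: mix_strat => [|j]; [exact: cst_strat|exact: mk].
have mB := @box_but_measurable _ _ _ _ _ cX i.
apply: (bounded_convergence mB (C := C)).
- move=> m; have /integrableP[] := play_integrable_but (mm _ (mh_ m)) Xt.
  by move=> /measurable_EFinP.
- by move=> m s Xs; apply: play_bounded; [exact: mm|exact: box_mix].
move=> s Xs; have Xts := box_mix Xt Xs.
apply: (@play_cvg i (fun m => mix (fun=> a) (but i (h_ m))) (mix (fun=> a) (but i h)) _
  (fun m => mm _ (mh_ m)) (mm _ mh) Xts) => j.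
have [ji|ji] := eqVneq j i.
  subst j; rewrite !mix_self (_ : (fun m => _) = cst a); first exact: cvg_cst.
  by apply/funext => m; rewrite mix_self.
have [k ->] : exists k : others i, j = sval k by exists (exist _ j ji).
rewrite !mix_other (_ : (fun m => _) = (fun m => h_ m (sval k) (s k))).
  by apply: hh; exact: Xs.
by apply/funext => m; rewrite mix_other.
Qed.

(** * The total directional derivative *)

Variable B : R.
Hypothesis AB : forall i x y, A i x -> A i y -> `|x - y| <= B.

Lemma segment_mstrat h y (s : R) : 0 <= s <= 1 -> mstrat h -> mstrat y ->
  mstrat (segment h y s).
Proof. by move=> s01 mh my j; exact: segment_strat. Qed.

Definition ddir i (h y : strategies) (th : forall i, 'rV[R]_(d i)) : R :=
  dir_deriv (own i h th) (h i (th i)) (y i (th i) - h i (th i)).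

(** The gain to first order when all players move from [h] towards [y], each
    computed as if alone.  Strict monotonicity of the game says that
    [total_deriv f g + total_deriv g f] is positive for distinct [f] and [g]. *)
Definition total_deriv (h y : strategies) : R :=
  \int[prior G]_(th in box X) \sum_i ddir i h y th.

Lemma slope_own i h y th s :
  slope (own i h th) (h i (th i)) (y i (th i)) s =
  s^-1 * (play i (mix (segment h y s i) (but i h)) th - play i h th).
Proof. by rewrite own_play -[play i h th]own_self. Qed.

Lemma ddir_cvg i h y th : mstrat h -> mstrat y -> box X th ->
  slope (own i h th) (h i (th i)) (y i (th i)) m.+1%:R^-1 @[m --> \oo] -->
  ddir i h y th.
Proof.
move=> mh my Xth; apply: (cvg_slope_seq (@vA i) (own_concave (i := i) mh Xth) (L := L)) => //.
- by move=> x y' Ax Ay; exact: own_lipschitz.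
- by apply: (mh i).1; exact: Xth.
- by apply: (my i).1; exact: Xth.
Qed.

Lemma slope_own_bounded i h y th (s : R) : mstrat h -> mstrat y -> box X th ->
  0 < s -> s <= 1 -> `|slope (own i h th) (h i (th i)) (y i (th i)) s| <= L * B.
Proof.
move=> mh my Xth s0 s1.
have Ah : A i (h i (th i)) by apply: (mh i).1; exact: Xth.
have Ay : A i (y i (th i)) by apply: (my i).1; exact: Xth.
apply: (@le_trans _ _ (L * `|y i (th i) - h i (th i)|)).
  apply: (slope_bounded (@vA i) (L := L)) => //.
  by move=> x y' Ax Ay'; exact: own_lipschitz.
by rewrite ler_wpM2l// AB.
Qed.

Lemma slope_own_measurable i h y (s : R) : mstrat h -> mstrat y -> 0 < s -> s <= 1 ->
  measurable_fun (box X : set (profile R d))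
    (fun th => slope (own i h th) (h i (th i)) (y i (th i)) s).
Proof.
move=> mh my s0 s1; rewrite (_ : (fun th => _) = (fun th =>
    s^-1 * (play i (mix (segment h y s i) (but i h)) th - play i h th))); last first.
  by apply/funext => th; rewrite slope_own.
apply: measurable_funM; first exact: measurable_cst.
apply: measurable_funB; apply: play_measurable => //.
apply: mix_strat => [|j]; last exact: mh.
by apply: segment_mstrat => //; rewrite (ltW s0).
Qed.

Lemma inv_succ01 m : 0 < m.+1%:R^-1 :> R /\ m.+1%:R^-1 <= 1 :> R.
Proof. by rewrite invr_gt0 ltr0n invf_le1 ?ltr0n// ler1n. Qed.

Lemma ddir_measurable i h y : mstrat h -> mstrat y ->
  measurable_fun (box X : set (profile R d)) (ddir i h y).
Proof.
move=> mh my; apply: (@measurable_fun_cvg _ (profile R d) R (box X) (fun m th =>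
  slope (own i h th) (h i (th i)) (y i (th i)) m.+1%:R^-1) (ddir i h y)) => [m|th Xth].
  by have [m0 m1] := inv_succ01 m; exact: slope_own_measurable.
exact: ddir_cvg.
Qed.

Lemma ddir_bounded i h y th : mstrat h -> mstrat y -> box X th ->
  `|ddir i h y th| <= L * B.
Proof.
move=> mh my Xth; apply: (cvgr_to_le (cvg_norm (ddir_cvg mh my Xth))).
apply: nearW => m; have [m0 m1] := inv_succ01 m; exact: slope_own_bounded.
Qed.

Lemma ddir_integrable i h y : mstrat h -> mstrat y ->
  (prior G).-integrable (box X : set (profile R d)) (EFin \o ddir i h y).
Proof.
move=> mh my; apply: (bounded_integrable _ (box_measurable cX) (C := L * B)).
  exact: ddir_measurable.
by move=> th Xth; exact: ddir_bounded.
Qed.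

Lemma total_derivE h y : mstrat h -> mstrat y ->
  total_deriv h y = \sum_i \int[prior G]_(th in box X) ddir i h y th.
Proof.
move=> mh my; rewrite /total_deriv (Rintegral_sumr (box_measurable cX))// => i.
exact: ddir_integrable.
Qed.

Lemma ddir_self i h y th : y i (th i) = h i (th i) -> ddir i h y th = 0.
Proof. by move=> yh; rewrite /ddir yh subrr dir_deriv0. Qed.

Lemma total_deriv_lipschitz h y y' e : mstrat h -> mstrat y -> mstrat y' ->
  0 <= e -> (forall j t, X j t -> `|y j t - y' j t| <= e) ->
  total_deriv h y - total_deriv h y' <= n%:R * (L * e).
Proof.
move=> mh my my' e0 yy'; rewrite !total_derivE// -sumrB.
apply: (@le_trans _ _ (\sum_(j < n) L * e)); last first.
  by rewrite sumr_const card_ord mulr_natl.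
apply: ler_sum => i _.
have iy := ddir_integrable i mh my; have iy' := ddir_integrable i mh my'.
rewrite -(RintegralB (box_measurable cX) iy iy').
apply: Rintegral_le_cst; [exact: box_measurable|by rewrite mulr_ge0| |].
  rewrite (_ : EFin \o _ = (EFin \o ddir i h y) \- (EFin \o ddir i h y'))%E; last exact/funext.
  exact: (integrableB (box_measurable cX) iy iy').
move=> th Xth; apply: (@le_trans _ _ (L * `|y i (th i) - y' i (th i)|)).
  apply: (dir_deriv_lipschitz (@vA i) (own_concave mh Xth)) => //.
  - by move=> x x' Ax Ax'; exact: own_lipschitz.
  - by apply: (mh i).1; exact: Xth.
  - by apply: (my i).1; exact: Xth.
  - by apply: (my' i).1; exact: Xth.
by rewrite ler_wpM2l// yy'//; exact: Xth.
Qed.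

Lemma total_deriv_concave h y y' (s : R) : mstrat h -> mstrat y -> mstrat y' ->
  0 <= s <= 1 ->
  total_deriv h y + s * (total_deriv h y' - total_deriv h y) <=
  total_deriv h (segment y y' s).
Proof.
move=> mh my my' s01; have ms := segment_mstrat s01 my my'.
rewrite !total_derivE//.
apply: (@le_trans _ _ (\sum_i (\int[prior G]_(th in box X) ddir i h y th +
    s * (\int[prior G]_(th in box X) ddir i h y' th -
         \int[prior G]_(th in box X) ddir i h y th)))).
  by rewrite big_split/= -mulr_sumr sumrB.
apply: ler_sum => i _.
have mB := box_measurable cX.
have iy := ddir_integrable i mh my; have iy' := ddir_integrable i mh my'.
have iyy' : (prior G).-integrable (box X : set (profile R d))
    (EFin \o (fun th => ddir i h y' th - ddir i h y th)).
  rewrite (_ : EFin \o _ = (EFin \o ddir i h y') \- (EFin \o ddir i h y))%E; last exact/funext.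
  exact: (integrableB mB iy' iy).
have isyy' : (prior G).-integrable (box X : set (profile R d))
    (EFin \o (fun th => s * (ddir i h y' th - ddir i h y th))).
  rewrite (_ : EFin \o _ = (fun th => s%:E *
     (ddir i h y' th - ddir i h y th)%R%:E))%E; last exact/funext.
  exact: (integrableZl mB s iyy').
have E := RintegralD mB iy isyy'.
rewrite (RintegralZl _ mB iyy') (RintegralB mB iy' iy) in E.
have icomb : (prior G).-integrable (box X : set (profile R d))
    (EFin \o (fun th => ddir i h y th + s * (ddir i h y' th - ddir i h y th))).
  rewrite (_ : EFin \o _ = (EFin \o ddir i h y) \+
    (EFin \o (fun th => s * (ddir i h y' th - ddir i h y th))%R))%E; last exact/funext.
  exact: (integrableD mB iy isyy').
rewrite -[leLHS]E; apply: (le_Rintegral mB icomb (ddir_integrable i mh ms)) => th Xth.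
apply: (dir_deriv_concave (@vA i) (own_concave mh Xth) (L := L)) => //.
- by move=> x x' Ax Ax'; exact: own_lipschitz.
- by apply: (mh i).1; exact: Xth.
- by apply: (my i).1; exact: Xth.
- by apply: (my' i).1; exact: Xth.
Qed.

(** The difference quotients have nonpositive conditional expectations at a best
    response, hence nonpositive prior integrals; let the step tend to [0]. *)
Lemma best_response_first_order i h y : mstrat h -> mstrat y ->
  (forall t, X i t -> best_responses G i (but i h) t (h i t)) ->
  \int[prior G]_(th in box X) ddir i h y th <= 0.
Proof.
move=> mh my br; have mB := box_measurable cX.
have cv : \int[prior G]_(th in box X)
    slope (own i h th) (h i (th i)) (y i (th i)) m.+1%:R^-1 @[m --> \oo] -->
    \int[prior G]_(th in box X) ddir i h y th.
  apply: (bounded_convergence mB (C := L * B)) => [m|m th Xth|th Xth].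
  - by have [m0 m1] := inv_succ01 m; exact: slope_own_measurable.
  - by have [m0 m1] := inv_succ01 m; exact: slope_own_bounded.
  - exact: ddir_cvg.
apply: (cvgr_to_le cv); apply: nearW => m; have [m0 m1] := inv_succ01 m.
set s : R := m.+1%:R^-1 in m0 m1 *.
have s01 : 0 <= s <= 1 by rewrite (ltW m0).
pose h' : strategies := mix (segment h y s i) (but i h).
have mh' : mstrat h'.
  by apply: mix_strat => [|j]; [exact: segment_mstrat|exact: mh].
under eq_Rintegral do rewrite slope_own.
have iP k : mstrat k -> (prior G).-integrable (box X : set (profile R d)) (EFin \o play i k).
  move=> mk; apply: (bounded_integrable _ mB (C := C)); first exact: play_measurable.
  by move=> th Xth; exact: play_bounded.
rewrite (RintegralZl _ mB); last first.
  rewrite (_ : EFin \o _ = (EFin \o play i h') \- (EFin \o play i h))%E; last exact/funext.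
  exact: (integrableB mB (iP _ mh') (iP _ mh)).
rewrite pmulr_rle0 ?invr_gt0//.
apply: (prior_integral_le0 (i := i) cX (C := C + C)).
- by apply: discretizableB; exact: discretizable_play.
- by move=> th Xth; rewrite (le_trans (ler_normB _ _))// lerD// play_bounded.
move=> t Xt; have mBi := @box_but_measurable _ _ _ _ _ cX i.
rewrite (RintegralB mBi (play_integrable_but mh' Xt) (play_integrable_but mh Xt)).
rewrite -[h in X in _ - X](mix_but i) -!rhoE subr_le0.
apply: (br t Xt).2; exact: (segment_mstrat s01 mh my i).1.
Qed.

Lemma own_perturb i h h' th x x' e : mstrat h -> mstrat h' -> box X th ->
  A i x -> A i x' -> 0 <= e -> `|x - x'| <= e ->
  (forall j, `|h j (th j) - h' j (th j)| <= e) ->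
  `|own i h th x - own i h' th x'| <= L * (n%:R * e).
Proof.
move=> mh mh' Xth Ax Ax' e0 xx' hh'.
apply: (le_trans (uL i (own_box Ax mh Xth) (own_box Ax' mh' Xth) Xth Xth)).
rewrite ler_wpM2l// [X in _ + X]big1 ?addr0; last by move=> j _; rewrite subrr normr0.
apply: (@le_trans _ _ (\sum_(j < n) e)); last by rewrite sumr_const card_ord mulr_natl.
apply: ler_sum => j _; have [ji|ji] := eqVneq j i; first by subst j; rewrite !mix_self.
have -> : j = sval (exist (fun j => is_true (j != i)) j ji) by [].
by rewrite !mix_other; exact: hh'.
Qed.

(** The passage from Minty's inequality to Stampacchia's.  Along the segment
    from [h] to [y], concavity bounds the forward difference quotient at
    [segment h y t] by the opposite of the backward derivative, whose integral
    Minty's inequality controls; then [t] tends to [0]. *)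
Lemma minty_stampacchia h y : mstrat h -> mstrat y ->
  (forall t, 0 < t < 1 -> 0 <= total_deriv (segment h y t) h) ->
  total_deriv h y <= 0.
Proof.
move=> mh my minty; have mB := box_measurable cX.
rewrite total_derivE//.
have cv : \sum_i \int[prior G]_(th in box X)
    slope (own i h th) (h i (th i)) (y i (th i)) m.+1%:R^-1 @[m --> \oo] -->
    \sum_i \int[prior G]_(th in box X) ddir i h y th.
  apply: cvg_sumr => i.
  apply: (bounded_convergence mB (C := L * B)) => [m|m th Xth|th Xth].
  - by have [m0 m1] := inv_succ01 m; exact: slope_own_measurable.
  - by have [m0 m1] := inv_succ01 m; exact: slope_own_bounded.
  - exact: ddir_cvg.
apply: (cvgr_to_le cv); exists 1%N => // m /= m_gt0.
have [s0 s1'] := inv_succ01 m; set s : R := m.+1%:R^-1 in s0 s1' *.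
have s1 : s < 1 by rewrite /s invf_lt1 ?ltr0n// ltr1n ltnS.
have B0 : 0 <= `|B| by [].
(* [K * t] bounds the error made by evaluating all difference quotients with
   step [s] at [segment h y t] instead of [h]. *)
pose K := 2 * (L * n%:R * `|B|) / s * n%:R.
have K0 : 0 <= K by rewrite !mulr_ge0 ?invr_ge0 ?(ltW s0).
suff key t : 0 < t -> t < 1 - s -> \sum_i \int[prior G]_(th in box X)
    slope (own i h th) (h i (th i)) (y i (th i)) s <= K * t.
  apply/ler_addgt0Pr => e e0; rewrite add0r.
  pose t := Num.min ((1 - s) / 2) (e / (K + 1)).
  have t0 : 0 < t by rewrite lt_min !divr_gt0//; lra.
  have t1 : t <= (1 - s) / 2 by rewrite ge_min lexx.
  apply: (le_trans (key t t0 _)); first by lra.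
  have : t <= e / (K + 1) by rewrite ge_min lexx orbT.
  by rewrite ler_pdivlMr; nra.
move=> t0 t1; have t01 : 0 <= t <= 1 by lra.
have mt := segment_mstrat t01 mh my; set ht := segment h y t in mt *.
apply: (@le_trans _ _ (\sum_i (2 * (L * n%:R * `|B|) / s * t -
    t^-1 * \int[prior G]_(th in box X) ddir i ht h th))); last first.
  rewrite sumrB sumr_const card_ord -mulr_sumr -(total_derivE mt mh).
  rewrite -[_ *+ n]mulr_natr mulrAC -/K gerBl mulr_ge0 ?invr_ge0 ?(ltW t0)//.
  by apply: minty; lra.
apply: ler_sum => i _; set c := _ / s * t.
have c0 : 0 <= c by rewrite !mulr_ge0 ?invr_ge0 ?(ltW s0) ?(ltW t0).
have ih : (prior G).-integrable (box X : set (profile R d)) (EFin \o ddir i ht h).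
  exact: ddir_integrable.
have ih' : (prior G).-integrable (box X : set (profile R d))
    (EFin \o (fun th => t^-1 * ddir i ht h th)).
  rewrite (_ : EFin \o _ = (fun th => t^-1%:E * (ddir i ht h th)%:E))%E; last exact/funext.
  exact: (integrableZl mB _ ih).
have isl : (prior G).-integrable (box X : set (profile R d))
    (EFin \o (fun th => slope (own i h th) (h i (th i)) (y i (th i)) s)).
  apply: (bounded_integrable _ mB (C := L * B)); first exact: slope_own_measurable.
  by move=> th Xth; exact: slope_own_bounded.
have E := RintegralD mB isl ih'.
rewrite (RintegralZl _ mB ih) in E.
rewrite lerBrDr -[leLHS]E; apply: (Rintegral_le_cst mB c0).
  rewrite (_ : EFin \o _ = (EFin \o (fun th => slope (own i h th) (h i (th i)) (y i (th i)) s))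
    \+ (EFin \o (fun th => t^-1 * ddir i ht h th)%R))%E; last exact/funext.
  exact: (integrableD mB isl ih').
move=> th Xth.
have Ah : A i (h i (th i)) by apply: (mh i).1; exact: Xth.
have Ay : A i (y i (th i)) by apply: (my i).1; exact: Xth.
have st1 : s + t <= 1 by lra.
have zE : ht i (th i) = h i (th i) + t *: (y i (th i) - h i (th i)) by [].
have ownL u v : A i u -> A i v -> `|own i ht th u - own i ht th v| <= L * `|u - v|.
  by move=> Au Av; exact: own_lipschitz.
have := slope_le_opp_dir_deriv (@vA i) (own_concave mt Xth) ownL Ah Ay s0 t0 st1 zE.
rewrite -/(ddir i ht h th).
have hht j : `|h j (th j) - ht j (th j)| <= t * `|B|.
  rewrite /ht /segment opprD addrA subrr add0r normrN normrZ gtr0_norm//.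
  rewrite ler_wpM2l ?(ltW t0)// (le_trans _ (ler_norm B))// AB//.
    by apply: (my j).1; exact: Xth.
  by apply: (mh j).1; exact: Xth.
have tB0 : 0 <= t * `|B| by rewrite mulr_ge0// ltW.
have Az : A i (ht i (th i)) by apply: (mt i).1; exact: Xth.
have s01 : 0 <= s <= 1 by lra.
have Axs : A i (h i (th i) + s *: (y i (th i) - h i (th i))) by exact: convexE.
have Azs : A i (ht i (th i) + s *: (y i (th i) - h i (th i))).
  rewrite zE -addrA -scalerDl; apply: convexE => //; lra.
have p1 := own_perturb mh mt Xth Ah Az tB0 (hht i) hht.
have hxs : `|h i (th i) + s *: (y i (th i) - h i (th i)) -
    (ht i (th i) + s *: (y i (th i) - h i (th i)))| <= t * `|B|.
  by rewrite opprD addrACA subrr addr0.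
have p2 := own_perturb mh mt Xth Axs Azs tB0 hxs hht.
move: p1 p2; rewrite !ler_norml => /andP[p1 _] /andP[_ p2] p3.
rewrite /slope; move: p1 p2 p3.
set a1 := own i h th (_ + _); set a0 := own i h th _.
set b1 := own i ht th (_ + _); set b0 := own i ht th _.
set w := t^-1 * _; set r := L * _ => p1 p2 p3.
have si0 : 0 <= s^-1 by rewrite invr_ge0 ltW.
have cE : c = s^-1 * (2 * r) by rewrite /c /r; ring.
have : s^-1 * (a1 - a0) <= s^-1 * (b1 - b0) + s^-1 * (2 * r).
  by rewrite -mulrDr ler_wpM2l//; lra.
by rewrite -cE; lra.
Qed.

(** * Best responses *)

Variables alpha nu tau : 'I_n -> R.
Hypotheses (alpha0 : forall i, 0 < alpha i) (nu0 : forall i, 0 < nu i)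
  (tau0 : forall i, 0 < tau i).
Hypothesis growth : forall i (f : forall j : others i, strategy (sval j)) t,
  (forall j, measurable_strat G (sval j) (f j)) -> X i t ->
  forall a, A i a -> - rho G i a f t >=
    - value G i f t + alpha i * (euclid_dist a (best_responses G i f t) `^ nu i).
Hypothesis rho_type_lipschitz : forall i a (f : forall j : others i, strategy (sval j)) t t',
  A i a -> (forall j, measurable_strat G (sval j) (f j)) -> X i t -> X i t' ->
  `|rho G i a f t - rho G i a f t'| <= tau i * enorm (t - t').

(** The form in which the growth condition is used: almost optimal actions are
    close to best responses. *)
Lemma near_optimal_near i h t a e : mstrat h -> X i t -> A i a -> 0 < e ->
  value G i (but i h) t - rho G i a (but i h) t < alpha i * e `^ nu i ->
  exists2 b, best_responses G i (but i h) t b & enorm (a - b) < e.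
Proof.
move=> mh Xt Aa e0 vr.
have := growth (f := but i h) (fun j => mh (sval j)) Xt Aa.
set D := euclid_dist _ _ => gr.
apply: euclid_dist_near; first exact: best_responses_neq0.
rewrite -/D ltNge; apply/negP => eD.
have : e `^ nu i <= D `^ nu i.
  by apply: ge0_ler_powR; rewrite ?nnegrE ?(ltW (nu0 i)) ?(ltW e0)// (le_trans (ltW e0)).
by rewrite -(ler_pM2l (alpha0 i)) => h1; lra.
Qed.

(** Best responses stay almost optimal at nearby types, because changing the type
    moves each of the two expected utilities by at most [tau i * enorm (t - t')]. *)
Lemma value_gap i h t t' a : mstrat h -> X i t -> X i t' ->
  best_responses G i (but i h) t a ->
  value G i (but i h) t' - rho G i a (but i h) t' <= 2 * tau i * enorm (t - t').
Proof.
move=> mh Xt Xt' [Aa amax].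
have [b brb] := best_responses_neq0 mh Xt'.
rewrite (value_best_response brb); have [Ab _] := brb.
have := rho_type_lipschitz (f := but i h) Aa (fun j => mh (sval j)) Xt Xt'.
have := rho_type_lipschitz (f := but i h) Ab (fun j => mh (sval j)) Xt Xt'.
rewrite !ler_norml => /andP[b1 _] /andP[_ a2].
by have := amax _ Ab; lra.
Qed.

Lemma best_responses_hausdorff i h e : mstrat h -> 0 < e ->
  exists2 r, 0 < r & forall t t', X i t -> X i t' -> `|t - t'| < r ->
    forall a, best_responses G i (but i h) t a ->
      exists2 b, best_responses G i (but i h) t' b & `|a - b| <= e.
Proof.
move=> mh e0; have ae : 0 < alpha i * e `^ nu i by rewrite mulr_gt0// powR_gt0.
have den : 0 < 2 * tau i * ((d i)%:R + 1).
  by rewrite !mulr_gt0// ltr_wpDl.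
exists (alpha i * e `^ nu i / (2 * tau i * ((d i)%:R + 1))); first exact: divr_gt0.
move=> t t' Xt Xt'; rewrite ltr_pdivlMr// => tt' a bra.
have gap := value_gap mh Xt Xt' bra.
have [|b brb ab] := near_optimal_near mh Xt' bra.1 e0.
  apply: (le_lt_trans gap); apply: le_lt_trans tt'.
  rewrite [leRHS]mulrC -!mulrA !ler_pM2l//.
  by rewrite (le_trans (enorm_le_norm _))// ler_wpM2r// lerDl.
by exists b => //; rewrite (le_trans (norm_le_enorm _))// ltW.
Qed.

Definition unique_best_response i h := forall t a b, X i t ->
  best_responses G i (but i h) t a -> best_responses G i (but i h) t b -> a = b.

(** Uniform over own actions: pointwise convergence of functions with a common
    Lipschitz constant on a compact set. *)
Lemma rho_cvg_uniform i (h_ : nat -> strategies) h t e :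
  (forall m, mstrat (h_ m)) -> mstrat h -> X i t ->
  (forall j t, X j t -> h_ m j t @[m --> \oo] --> h j t) -> 0 < e ->
  \forall m \near \oo, forall a, A i a ->
    `|rho G i a (but i (h_ m)) t - rho G i a (but i h) t| <= e.
Proof.
move=> mh_ mh Xt hh e0.
have e3 : 0 < e / 3 by exact: divr_gt0.
have L1 : 0 < L + 1 by exact: ltr_wpDl.
have [s [sA sn]] := finite_net (@cA i) (divr_gt0 e3 L1).
have : \forall m \near \oo, forall x, x \in s ->
    `|rho G i x (but i h) t - rho G i x (but i (h_ m)) t| <= e / 3.
  elim: s sA {sn} => [|x s IH] sA; first by apply: nearW.
  have /cvgrPdist_le /(_ _ e3) hx := rho_cvg mh_ mh (sA x (mem_head _ _)) Xt hh.
  have {}IH := IH (fun y ys => sA y (mem_behead (s := x :: s) ys)).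
  near=> m => y; rewrite inE => /predU1P[->|].
    by near: m.
  by move: y; near: m.
apply: filterS => m hm a Aa.
have [x xs xa] := sn _ Aa; have Ax := sA _ xs.
have Lxa : L * `|x - a| <= e / 3.
  rewrite ltr_pdivlMr// in xa; have := normr_ge0 (x - a); nra.
have h1 := rho_lipschitz (mh_ m) Ax Aa Xt; have h2 := rho_lipschitz (mh_ m) Aa Ax Xt.
have h3 := rho_lipschitz mh Ax Aa Xt; have h4 := rho_lipschitz mh Aa Ax Xt.
rewrite [`|a - x|]distrC in h2 h4.
have := hm x xs; rewrite !ler_norml => /andP[h5 h6].
by apply/andP; split; lra.
Unshelve. all: by end_near.
Qed.

(** The growth condition is uniform over the strategies of the others, so two
    best responses to a limit are both close to the best response to a nearby
    term of the sequence. *)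
Lemma unique_best_response_limit i (h_ : nat -> strategies) h :
  (forall m, mstrat (h_ m)) -> mstrat h ->
  (forall j t, X j t -> h_ m j t @[m --> \oo] --> h j t) ->
  (forall m, unique_best_response i (h_ m)) -> unique_best_response i h.
Proof.
move=> mh_ mh hh uh_ t a b Xt bra brb.
apply/eqP; rewrite -subr_eq0 -normr_le0; apply/ler_addgt0Pr => e e0; rewrite add0r.
have e2 : 0 < e / 2 by exact: divr_gt0.
pose q := alpha i * (e / 2) `^ nu i.
have q0 : 0 < q by rewrite mulr_gt0// powR_gt0.
have q3 : 0 < q / 3 by exact: divr_gt0.
have [m hm] := @filter_ex _ \oo _ _ (rho_cvg_uniform mh_ mh Xt hh q3).
have close x : best_responses G i (but i h) t x ->
    exists2 y, best_responses G i (but i (h_ m)) t y & enorm (x - y) < e / 2.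
  move=> [Ax xmax]; apply: near_optimal_near => //.
  have [y bry] := best_responses_neq0 (mh_ m) Xt; rewrite (value_best_response bry).
  have := hm x Ax; have := hm y bry.1; have := xmax _ bry.1.
  rewrite !ler_norml => h1 /andP[h2 h3] /andP[h4 h5].
  by rewrite -/q; lra.
have [y bry ay] := close _ bra; have [y' bry' by'] := close _ brb.
rewrite -(uh_ m t y y' Xt bry bry') in by'.
have -> : a - b = (a - y) - (b - y) by rewrite opprB addrA subrK.
rewrite (le_trans (ler_normB _ _))//.
by have := norm_le_enorm (a - y); have := norm_le_enorm (b - y); lra.
Qed.

Lemma but_mix i (y : strategy i) (f : forall j : others i, strategy (sval j)) :
  but i (mix y f) = f.
Proof. by apply: functional_extensionality_dep => j; rewrite /but mix_other. Qed.

(** Only the deviating player contributes, and to first order nothing is gained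
    by leaving a best response. *)
Lemma total_deriv_deviation i h y : mstrat h -> mstrat y ->
  (forall t, X i t -> best_responses G i (but i h) t (h i t)) ->
  (forall j, j != i -> y j = h j) -> total_deriv h y <= 0.
Proof.
move=> mh my br yh; rewrite total_derivE// (bigD1 i)//= big1 ?addr0.
  exact: best_response_first_order.
move=> j ji; rewrite (_ : Rintegral _ _ _ = \int[prior G]_(th in box X) (0 : R)).
  by rewrite (Rintegral_cst _ (box_measurable cX)) mul0r.
by apply: eq_Rintegral => th _; rewrite ddir_self// yh.
Qed.

Lemma total_derivD h y : mstrat h -> mstrat y ->
  \int[prior G]_(th in box X) \sum_i (ddir i h y th + ddir i y h th) =
  total_deriv h y + total_deriv y h.
Proof.
move=> mh my; have mB := box_measurable cX.
have ih i := ddir_integrable i mh my; have iy i := ddir_integrable i my mh.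
have := RintegralD mB (integrable_sumr mB (index_enum 'I_n) ih)
  (integrable_sumr mB (index_enum 'I_n) iy).
rewrite -/(total_deriv h y) -/(total_deriv y h) => <-.
by apply: eq_Rintegral => th _; rewrite big_split.
Qed.

Hypothesis monotone : forall f g : strategies,
  (forall i, continuous_strat G i (f i)) -> (forall i, continuous_strat G i (g i)) ->
  ~ eq_strat G f g -> 0 < total_deriv f g + total_deriv g f.

Lemma mix_continuous_strat i (y : strategy i) h : continuous_strat G i y ->
  (forall j, continuous_strat G j (h j)) ->
  forall j, continuous_strat G j (mix y (but i h) j).
Proof.
move=> cy ch j; have [ji|ji] := eqVneq j i; first by subst j; rewrite mix_self.
by have -> : j = sval (exist (fun j => is_true (j != i)) j ji) by []; rewrite mix_other.
Qed.

(** Two best responses at one type extend to two continuous selections of best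
    responses; deviating from either to the other gains nothing to first order,
    which contradicts strict monotonicity. *)
Lemma unique_best_response_continuous i h : (forall j, continuous_strat G j (h j)) ->
  unique_best_response i h.
Proof.
move=> ch t a b Xt bra brb.
have mh : mstrat h by move=> j; exact: continuous_strat_measurable.
pose S := best_responses G i (but i h).
have sel p := @continuous_selection R _ _ (X i) (A i) S (@cA i)
  (fun t _ a => fun Sa : S t a => Sa.1) (fun t Xt => best_responses_neq0 mh Xt)
  (fun t Xt => best_responses_closed mh Xt) (fun t Xt => best_responses_convex mh Xt)
  (fun e e0 => best_responses_hausdorff i mh e0) p.
have [sa [Sa ca saE]] := sel a; have [sb [Sb cb sbE]] := sel b.
apply: contrapT => ab.
pose f := mix sa (but i h); pose g := mix sb (but i h).
have cf : forall j, continuous_strat G j (f j).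
  by apply: mix_continuous_strat => //; split => // t' Xt'; exact: (Sa _ Xt').1.
have cg : forall j, continuous_strat G j (g j).
  by apply: mix_continuous_strat => //; split => // t' Xt'; exact: (Sb _ Xt').1.
have mf : mstrat f by move=> j; exact: continuous_strat_measurable.
have mg : mstrat g by move=> j; exact: continuous_strat_measurable.
have off j : j != i -> f j = g j.
  move=> ji; have -> : j = sval (exist (fun j => is_true (j != i)) j ji) by [].
  by rewrite /f /g !mix_other.
have fg : ~ eq_strat G f g.
  by move=> /(_ i t Xt); rewrite /f /g !mix_self (saE _ Xt bra) (sbE _ Xt brb).
have h1 : total_deriv f g <= 0.
  apply: (total_deriv_deviation (i := i)) => // [t' Xt'|j ji]; last by rewrite off.
  by rewrite /f but_mix mix_self; exact: Sa.
have h2 : total_deriv g f <= 0.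
  apply: (total_deriv_deviation (i := i)) => // t' Xt'.
  by rewrite /g but_mix mix_self; exact: Sb.
by have := lt_le_trans (monotone cf cg fg) (lerD h1 h2); rewrite addr0 ltxx.
Qed.

(** Replace continuous strategies by measurable ones for one player after the
    other; each replacement is an induction on the Baire class. *)
Lemma unique_best_response_measurable i h : mstrat h -> unique_best_response i h.
Proof.
suff H (s : seq 'I_n) : forall h, mstrat h ->
    (forall j, j \notin s -> continuous_strat G j (h j)) -> unique_best_response i h.
  by move=> mh; apply: (H (enum 'I_n)) => // j; rewrite mem_enum.
elim: s => [|j s IH] {}h mh ch.
  by apply: unique_best_response_continuous => j; exact: ch.
have bh : baire (X j) (A j) (h j).
  by apply: measurable_baire => //; [exact: actions_neq0|exact: (mh j).1|exact: (mh j).2].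
have mm p : measurable_strat G j p -> mstrat (mix p (but j h)).
  by move=> mp; apply: mix_strat => // k; exact: mh.
have bm p : baire (X j) (A j) p -> measurable_strat G j p.
  by move=> bp; split; [exact: baire_range bp|exact: baire_measurable bp].
rewrite -(mix_but j h); elim: bh => [p pA pc|p_ p bp_ IHp pA pp].
  apply: IH => [|k ks]; first by apply: mm; exact: continuous_strat_measurable.
  have [kj|kj] := eqVneq k j; first by subst k; rewrite mix_self.
  have -> : k = sval (exist (fun l => is_true (l != j)) k kj) by [].
  by rewrite mix_other; apply: ch; rewrite inE negb_or kj.
apply: (unique_best_response_limit (h_ := fun m => mix (p_ m) (but j h))) => //.
- by move=> m; apply: mm; exact: bm.
- by apply: mm; apply: bm; exact: baire_limit pp.
- move=> k t Xt; have [kj|kj] := eqVneq k j.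
    subst k; rewrite mix_self (_ : (fun m => _) = (fun m => p_ m t)); first exact: pp.
    by apply/funext => m; rewrite mix_self.
  have [l kl] : exists l : others j, k = sval l by exists (exist _ k kj).
  subst k; rewrite mix_other (_ : (fun m => _) = cst (h (sval l) t)); first exact: cvg_cst.
  by apply/funext => m; rewrite mix_other.
Qed.

(** * Existence and uniqueness *)

(** The solution [x] of [alpha i * x `^ nu i = 2 * tau i * enorm (t - t')]: growth
    at one type against the loss incurred by moving the type. *)
Definition modulus i (t t' : 'rV[R]_(d i)) : R :=
  (2 * tau i / alpha i * enorm (t - t')) `^ (nu i)^-1.

Lemma best_response_modulus i h t t' a b : mstrat h -> X i t -> X i t' ->
  best_responses G i (but i h) t a -> best_responses G i (but i h) t' b ->
  `|a - b| <= modulus t t'.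
Proof.
move=> mh Xt Xt' bra brb; apply/ler_addgt0Pr => e e0.
have m0 : 0 <= modulus t t' by exact: powR_ge0.
have me0 : 0 < modulus t t' + e by exact: ltr_wpDl.
have q0 : 0 <= 2 * tau i / alpha i * enorm (t - t').
  by rewrite mulr_ge0 ?sqrtr_ge0// divr_ge0 ?(ltW (alpha0 i))// mulr_ge0// ltW.
have gap := value_gap mh Xt Xt' bra.
have [|b' brb' ab] := near_optimal_near mh Xt' bra.1 me0.
  apply: (le_lt_trans gap).
  have : modulus t t' `^ nu i < (modulus t t' + e) `^ nu i.
    by apply: gt0_ltr_powR; rewrite ?nnegrE// ?ltrDl// ltW.
  rewrite /modulus -powRrM mulVf ?gt_eqF// powRr1// -/(modulus t t').
  rewrite -(ltr_pM2l (alpha0 i)); apply: le_lt_trans.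
  by rewrite mulrA mulrCA mulfV ?gt_eqF// mulr1.
rewrite -(unique_best_response_measurable mh Xt' brb' brb).
by rewrite (le_trans (norm_le_enorm _))// ltW.
Qed.

Lemma modulus_small i (e : R) : 0 < e -> exists2 r, 0 < r &
  forall t t' : 'rV[R]_(d i), X i t -> X i t' -> `|t - t'| < r -> modulus t t' <= e.
Proof.
move=> e0; have e1 : 0 < e `^ nu i by rewrite powR_gt0.
pose k := 2 * tau i / alpha i; have k0 : 0 < k by rewrite divr_gt0// mulr_gt0.
have den : 0 < k * ((d i)%:R + 1) by rewrite mulr_gt0// ltr_wpDl.
exists (e `^ nu i / (k * ((d i)%:R + 1))); first exact: divr_gt0.
move=> t t' _ _; rewrite ltr_pdivlMr// => tt'.
have -> : e = (e `^ nu i) `^ (nu i)^-1.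
  by rewrite -powRrM mulfV ?gt_eqF// powRr1// ltW.
apply: ge0_ler_powR; rewrite ?nnegrE ?invr_ge0 ?(ltW (nu0 i)) ?(ltW e1)//.
  by rewrite mulr_ge0 ?sqrtr_ge0// ltW.
apply: le_trans (ltW tt'); rewrite -/k [leRHS]mulrC -[leRHS]mulrA ler_pM2l//.
by rewrite (le_trans (enorm_le_norm _))// ler_wpM2r// lerDl.
Qed.

Lemma modulus_continuous_strat i (f : strategy i) : (forall t, X i t -> A i (f t)) ->
  (forall t t', X i t -> X i t' -> `|f t - f t'| <= modulus t t') ->
  continuous_strat G i f.
Proof.
move=> fA fm; split => //; apply/continuous_withinP => t Xt e e0.
have [r r0 Hr] := modulus_small i (divr_gt0 e0 (ltr0n R 2)).
exists r => // t' Xt' tt'; apply: (le_lt_trans (fm _ _ Xt Xt')).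
by apply: (le_lt_trans (Hr _ _ Xt Xt' tt')); lra.
Qed.

Lemma equilibrium_continuous f : bf_equilibrium G f ->
  forall i, continuous_strat G i (f i).
Proof.
move=> [mf br] i; apply: modulus_continuous_strat => [t Xt|t t' Xt Xt'].
  exact: (br i t Xt).1.
by apply: (best_response_modulus mf) => //; exact: br.
Qed.

Lemma equilibrium_unique f g : bf_equilibrium G f -> bf_equilibrium G g ->
  eq_strat G f g.
Proof.
move=> ef eg; apply: contrapT => fg.
have pos := monotone (equilibrium_continuous ef) (equilibrium_continuous eg) fg.
have le0 h y : bf_equilibrium G h -> bf_equilibrium G y -> total_deriv h y <= 0.
  move=> [mh br] [my _]; rewrite total_derivE// sumr_le0// => i _.
  by apply: best_response_first_order => // t Xt; exact: br.
by have := lt_le_trans pos (lerD (le0 _ _ ef eg) (le0 _ _ eg ef)); rewrite addr0 ltxx.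
Qed.

(** A solution [f] of Minty's inequality among the strategies with this modulus
    is an equilibrium.  If [b] is the best response of one player to [f], then
    replacing [f i] by [b] stays in the class, so by Stampacchia's inequality
    the deviation from [f] to [b] gains nothing to first order; nor does the
    return from the best response; strict monotonicity forces [f i] to be [b]. *)
Lemma equilibrium_exists : exists f, bf_equilibrium G f.
Proof.
pose K := equi X A modulus.
have Kc f : K f -> forall i, continuous_strat G i (f i).
  by move=> [fA fw] i; apply: modulus_continuous_strat => [t _|]; [exact: fA|exact: fw].
have Km f : K f -> mstrat f.
  by move=> /Kc cf i; exact: continuous_strat_measurable.
have mono h y : K h -> K y -> 0 <= total_deriv h y + total_deriv y h.
  move=> Kh Ky; have [hy|] := pselect (eq_strat G h y); last first.
    by move=> hy; apply/ltW/monotone => //; exact: Kc.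
  have z0 f g : mstrat f -> mstrat g -> eq_strat G g f -> total_deriv f g = 0.
    move=> mf mg fg; rewrite total_derivE// big1// => i _.
    rewrite (_ : Rintegral _ _ _ = \int[prior G]_(th in box X) (0 : R)).
      by rewrite (Rintegral_cst _ (box_measurable cX)) mul0r.
    by apply: eq_Rintegral => th /set_mem Xth; rewrite ddir_self// fg//; exact: Xth.
  have hy0 : total_deriv h y = 0.
    by apply: z0; [exact: Km|exact: Km|move=> i t Xt; rewrite hy].
  have yh0 : total_deriv y h = 0 by apply: z0; [exact: Km|exact: Km|exact: hy].
  by rewrite hy0 yh0 addr0.
have [f Kf minty] : exists2 f, K f & forall g, K g -> 0 <= total_deriv g f.
  apply: (@minty_solution R n d z X A modulus cX cA (actions_neq0 _ _ _ _ G) vA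
    (fun i t t' => powR_ge0 _ _) modulus_small total_deriv (n%:R * L)).
  - by rewrite mulr_ge0.
  - by move=> h y y' s Kh Ky Ky' s01; apply: total_deriv_concave => //; exact: Km.
  - exact: mono.
  - move=> h y y' e Kh Ky Ky' e0 yy'; rewrite -mulrA.
    by apply: total_deriv_lipschitz => //; exact: Km.
have stampacchia g : K g -> total_deriv f g <= 0.
  move=> Kg; apply: minty_stampacchia; [exact: Km|exact: Km|move=> t /andP[t0 t1]].
  by apply: minty; apply: equi_segment => //; rewrite (ltW t0) (ltW t1).
exists f; split=> [|i t Xt]; first exact: Km.
(* Off the types any action will do, but there must be one: the class asks for
   values in [A i] everywhere. *)
have /choice[b Hb] : forall t, exists a, A i a /\
    (X i t -> best_responses G i (but i f) t a).
  move=> t'; case: (pselect (X i t')) => Xt'.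
    by have [a bra] := best_responses_neq0 (Km _ Kf) Xt'; exists a; split => //; exact: bra.1.
  by have [a Aa] := actions_neq0 _ _ _ _ G i; exists a.
pose g := mix b (but i f).
have off j : j != i -> g j = f j.
  move=> ji; have -> : j = sval (exist (fun j => is_true (j != i)) j ji) by [].
  by rewrite /g mix_other.
have Kg : K g.
  split=> [j t'|j t' t'' Xt' Xt''].
    have [ji|ji] := eqVneq j i; first by subst j; rewrite /g mix_self; exact: (Hb t').1.
    by rewrite off//; exact: Kf.1.
  have [ji|ji] := eqVneq j i; last by rewrite off//; exact: Kf.2.
  subst j; rewrite /g mix_self; apply: (best_response_modulus (Km _ Kf)) => //.
    exact: (Hb t').2.
  exact: (Hb t'').2.
have gf : total_deriv g f <= 0.
  apply: (total_deriv_deviation (i := i)); [exact: Km|exact: Km| |by move=> j /off].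
  by move=> t' Xt'; rewrite /g but_mix mix_self; exact: (Hb t').2.
have fg := stampacchia g Kg.
have [E|nE] := pselect (eq_strat G f g).
  by rewrite E// /g mix_self; exact: (Hb t).2.
by have := lt_le_trans (monotone (Kc _ Kf) (Kc _ Kg) nE) (lerD fg gf); rewrite addr0 ltxx.
Qed.

End game.

Theorem theorem3p4 (R : realType) (n : nat) (d z : 'I_n -> nat)
  (G : bayesian_game R d z)
  (A1 : forall (i : 'I_n) (S : set (profile_but R d i)),
    measurable S -> S `<=` box_but (types G) i ->
    {within types G i, continuous (fun t => cond G i t S)})
  (A2 : forall i : 'I_n, exists alpha nu : R, [/\ 0 < alpha, 0 < nu &
    forall (f : forall j : others i, 'rV[R]_(d (sval j)) -> 'rV[R]_(z (sval j)))
        (t : 'rV[R]_(d i)),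
      (forall j, measurable_strat G (sval j) (f j)) -> types G i t ->
      forall a' : 'rV[R]_(z i), actions G i a' ->
        - rho G i a' f t >=
          - value G i f t + alpha * (euclid_dist a' (best_responses G i f t) `^ nu)])
  (A3 : forall i : 'I_n, exists2 tau : R, 0 < tau &
    forall (a : 'rV[R]_(z i))
        (f : forall j : others i, 'rV[R]_(d (sval j)) -> 'rV[R]_(z (sval j)))
        (t t' : 'rV[R]_(d i)),
      actions G i a -> (forall j, measurable_strat G (sval j) (f j)) ->
      types G i t -> types G i t' ->
      `|rho G i a f t - rho G i a f t'| <= tau * enorm (t - t'))
  (A4 : forall i : 'I_n,
    [/\ compact (actions G i), convex_set (actions G i),
        compact (types G i) & convex_set (types G i)])
  (Ha : forall i : 'I_n, lipschitz_utility G i /\ concave_utility G i)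
  (Hb : forall f g : (forall i, 'rV[R]_(d i) -> 'rV[R]_(z i)),
    (forall i, continuous_strat G i (f i)) -> (forall i, continuous_strat G i (g i)) ->
    ~ eq_strat G f g ->
    0 < \int[prior G]_(th in box (types G))
          \sum_(i < n)
            (utility_deriv G i (f i (th i)) (but i (fun j => f j (th j))) th
               (g i (th i) - f i (th i)) +
             utility_deriv G i (g i (th i)) (but i (fun j => g j (th j))) th
               (f i (th i) - g i (th i)))) :
  exists f : (forall i, 'rV[R]_(d i) -> 'rV[R]_(z i)),
    bf_equilibrium G f /\
    forall g : (forall i, 'rV[R]_(d i) -> 'rV[R]_(z i)),
      bf_equilibrium G g -> eq_strat G g f.
Proof.
have cA i : compact (actions G i) by case: (A4 i).
have vA i : convex_set (actions G i) by case: (A4 i).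
have cX i : compact (types G i) by case: (A4 i).
have [L L0 uL] := lipschitz_utility_norm (fun i => (Ha i).1).
have conc i : concave_utility G i := (Ha i).2.
have [C _ uC] := utility_bounded cA cX L0 uL.
have [B AB] := actions_diameter cA.
have /choice[alpha /choice[nu growth]] := A2.
have /choice[tau Htau] : forall i, exists tau : R, 0 < tau /\
    forall (a : 'rV[R]_(z i))
      (f : forall j : others i, 'rV[R]_(d (sval j)) -> 'rV[R]_(z (sval j)))
      (t t' : 'rV[R]_(d i)),
    actions G i a -> (forall j, measurable_strat G (sval j) (f j)) ->
    types G i t -> types G i t' ->
    `|rho G i a f t - rho G i a f t'| <= tau * enorm (t - t').
  by move=> i; have [tau] := A3 i; exists tau.
have alpha0 i : 0 < alpha i by case: (growth i).
have nu0 i : 0 < nu i by case: (growth i).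
have gr i : _ := let: And3 _ _ g := growth i in g.
have tau0 i : 0 < tau i := (Htau i).1.
have monotone f g : (forall i, continuous_strat G i (f i)) ->
    (forall i, continuous_strat G i (g i)) -> ~ eq_strat G f g ->
    0 < total_deriv G f g + total_deriv G g f.
  move=> cf cg fg; rewrite -(total_derivD cA vA cX L0 uL conc AB).
  - exact: Hb.
  - by move=> i; exact: continuous_strat_measurable.
  - by move=> i; exact: continuous_strat_measurable.
have [f ef] := equilibrium_exists cA vA cX L0 uL conc uC AB alpha0 nu0 tau0 gr
  (fun i => (Htau i).2) monotone.
exists f; split => // g eg.
exact: (equilibrium_unique cA vA cX L0 uL conc uC AB alpha0 nu0 tau0 gr
  (fun i => (Htau i).2) monotone eg ef).
Qed.
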